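(* Let $(W,S)$ be of type $D_{n+2}$ with $S=\{0^+,0^-,1,\dots,n\}$. For $1\leq i\leq n$ and $y\in\{w_{i0^+},w_{i0^-},w_{0^+i},w_{0^-i}\}$, $$p_{e,y}=v^{\ell(y)}+v^{\ell(y)-2}+\cdots+v^{\ell(y)-2(n-i)}.$$
   Context: Type $D_{n+2}$ (with $n\geq2$): the Coxeter diagram is simply laced with nodes $0^+,0^-,1,\dots,n$; edges $m-(m+1)$ for $1\leq m<n$, and $0^+-1$, $0^--1$. $w_0$ is the longest element, $\ell$ the length function, $e$ the identity. Let $\widehat{\cdot}$ be the identity map on $S$ if $n$ is even, and the map swapping $0^+\leftrightarrow0^-$ and fixing the other elements if $n$ is odd. For $i,j\in S$ let $s_{ij}=i\cdots j$ be the product of simple reflections along the unique shortest path from $i$ to $j$ in the diagram, and $w_{ij}=s_{i\,\widehat\jmath}\cdot w_0$. ($w_{ij}$ is the unique element of the penultimate two-sided Kazhdan–Lusztig cell with unique left ascent $i$ and unique right ascent $j$.) Kazhdan–Lusztig polynomials: the Hecke algebra over $\mathbb Z[v,v^{-1}]$ is generated by $H_s$, $s\in S$, with the braid relations and $(H_s+v)(H_s-v^{-1})=0$; $H_w$ is the standard basis; the bar involution satisfies $\overline v=v^{-1}$, $\overline{H_s}=H_s^{-1}$. $\underline H_w$ is the unique bar-invariant element of the form $H_w+\sum_{y<w}p_{y,w}H_y$ with $p_{y,w}\in v\mathbb Z[v]$. *)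

(* Defs.v *)
From HB Require Import structures.
From mathcomp Require Import all_boot all_order all_algebra all_fingroup.
From mathcomp Require Import boolp.

Set Implicit Arguments.
Unset Strict Implicit.
Unset Printing Implicit Defensive.

Import GRing.Theory.
Local Open Scope ring_scope.

(* Z[v, v^-1], as the subring of Z(v) of all fractions p / v^k with p in Z[v];
   the polynomial variable 'X plays the role of v. *)

Definition laurent_pred : {pred {fraction {poly int}}} :=
  fun x => `[< exists (k : nat) (p : {poly int}), x * tofrac 'X^k = tofrac p >].

Fact laurent_subring : subring_closed laurent_pred.
Proof.
split.
- by apply/asboolP; exists 0, 1; rewrite expr0 mul1r.
- move=> x y /asboolP[k [p xE]] /asboolP[l [q yE]].
  apply/asboolP; exists (k + l)%N, (p * 'X^l - q * 'X^k).
  rewrite exprD rmorphB !rmorphM /= -xE -yE mulrBl.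
  by congr (_ - _); rewrite -?mulrA // [tofrac 'X^l * _]mulrC.
- move=> x y /asboolP[k [p xE]] /asboolP[l [q yE]].
  apply/asboolP; exists (k + l)%N, (p * q).
  by rewrite exprD !rmorphM /= -xE -yE mulrACA.
Qed.

HB.instance Definition _ := GRing.isSubringClosed.Build
  {fraction {poly int}} laurent_pred laurent_subring.

Record laurent := Laurent {
  laurent_val :> {fraction {poly int}};
  _ : laurent_val \in laurent_pred }.

HB.instance Definition _ := [isSub for laurent_val].
HB.instance Definition _ := [Choice of laurent by <:].
HB.instance Definition _ := [SubChoice_isSubComNzRing of laurent by <:].

Fact laurent_v_subproof : tofrac 'X \in laurent_pred.
Proof. by apply/asboolP; exists 0, 'X; rewrite expr0 mulr1. Qed.

Fact laurent_vV_subproof : (tofrac 'X)^-1 \in laurent_pred.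
Proof.
apply/asboolP; exists 1, 1; rewrite expr1 mulVf //.
by rewrite tofrac_eq0 polyX_eq0.
Qed.

Definition vL : laurent := Laurent laurent_v_subproof.
Definition vLV : laurent := Laurent laurent_vV_subproof.

Definition in_vZv (x : laurent) : Prop :=
  exists q : {poly int}, laurent_val x = tofrac ('X * q).

(* (W, S) is the Coxeter system with Coxeter matrix m: W is generated by the
   images of S and is presented by the relations (s t)^m(s,t) = 1. *)
Record coxeter_system (W : finGroupType) (S : finType) (m : S -> S -> nat) :=
  CoxeterSystem {
    simple :> S -> W;
    simple_gen : forall w : W,
      exists k, [exists t : k.-tuple S, w == \prod_(s <- t) simple s]%g;
    simple_rel : forall s t : S, ((simple s * simple t) ^+ m s t = 1)%g;
    simple_univ : forall (G : groupType) (f : S -> G),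
      (forall s t : S, ((f s * f t) ^+ m s t = 1)%g) ->
      exists2 phi : W -> G, {morph phi : x y / (x * y)%g} &
                            forall s, phi (simple s) = f s }.

Section Coxeter.

Variables (W : finGroupType) (S : finType) (m : S -> S -> nat).
Variable D : coxeter_system W m.

Definition ell (w : W) : nat := ex_minn (simple_gen D w).

Definition reduced_word (ws : seq S) (w : W) : Prop :=
  (\prod_(s <- ws) D s)%g = w /\ size ws = ell w.

Definition reflections : {set W} := [set (D s ^ w)%g | s in S, w in W].

Definition bruhat_step : rel W :=
  fun x y => [exists t in reflections, y == (x * t)%g] && (ell x < ell y)%N.

Definition bruhat_lt : rel W :=
  fun x y => (x != y) && connect bruhat_step x y.

Definition longest : W := [arg max_(w > 1%g) ell w].

(* The alternating word s t s ... with k letters. *)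
Fixpoint alt_word (s t : S) (k : nat) : seq S :=
  if k is k'.+1 then s :: alt_word t s k' else [::].

(* A is the Hecke algebra with generators H_s (normalised by
   (H_s + v)(H_s - v^-1) = 0) and standard basis H_w = H_{s1} ... H_{sk},
   for any reduced expression w = s1 ... sk. *)
Record hecke_algebra (A : algType laurent) (Hs : S -> A) (H : W -> A) : Prop :=
  HeckeAlgebra {
    hecke_quad : forall s, (Hs s + vL%:A) * (Hs s - vLV%:A) = 0;
    hecke_braid : forall s t,
      \prod_(r <- alt_word s t (m s t)) Hs r =
      \prod_(r <- alt_word t s (m s t)) Hs r;
    hecke_std : forall w ws, reduced_word ws w -> H w = \prod_(s <- ws) Hs s;
    hecke_basis : forall a : A,
      exists! c : {ffun W -> laurent}, a = \sum_w c w *: H w }.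

(* The conditions determine bar, as the algebra is generated over Z by
   v, v^-1 and the H_s. *)
Record bar_involution (A : algType laurent) (Hs : S -> A)
    (bar : {rmorphism A -> A}) : Prop :=
  BarInvolution {
    bar_inv : involutive bar;
    bar_v : bar vL%:A = vLV%:A;
    bar_Hs : forall s, bar (Hs s) * Hs s = 1 /\ Hs s * bar (Hs s) = 1 }.

Definition KL_element (A : algType laurent) (H : W -> A)
    (p : W -> W -> laurent) (w : W) : A :=
  H w + \sum_(y | bruhat_lt y w) p y w *: H y.

(* p y w is only constrained (and then uniquely determined) for y < w. *)
Definition KL_polynomials (A : algType laurent) (H : W -> A) (bar : A -> A)
    (p : W -> W -> laurent) : Prop :=
  forall w, bar (KL_element H p w) = KL_element H p w /\
            forall y, bruhat_lt y w -> in_vZv (p y w).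

End Coxeter.

Section Paths.

Variables (T : finType) (e : rel T).

Definition dist (x y : T) : nat :=
  find (fun k => [exists t : k.-tuple T, path e x t && (last x t == y)])
       (iota 0 #|T|).

(* The vertices of a shortest path from x to y, both ends included. *)
Definition shortest_path (x y : T) : seq T :=
  x :: oapp val [::]
    [pick t : (dist x y).-tuple T | path e x t && (last x t == y)].

End Paths.

(* The nodes of the diagram D_{n+2}: Some 0 is 0^+, None is 0^-, and Some k
   is the node k for 1 <= k <= n. *)
Definition Dnode (n : nat) : finType := option 'I_n.+1.

Definition node0p (n : nat) : Dnode n := Some ord0.
Definition node0m (n : nat) : Dnode n := None.

Definition Dadj (n : nat) : rel (Dnode n) := fun i j =>
  match i, j with
  | Some a, Some b => (a.+1 == b :> nat) || (b.+1 == a :> nat)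
  | Some a, None | None, Some a => a == 1%N :> nat
  | None, None => false
  end.

Definition Dmat (n : nat) (i j : Dnode n) : nat :=
  if i == j then 1 else if Dadj i j then 3 else 2.

Definition Dhat (n : nat) (j : Dnode n) : Dnode n :=
  if odd n then
    if j == node0p n then node0m n
    else if j == node0m n then node0p n else j
  else j.

Definition s_elt (n : nat) (W : finGroupType)
    (D : coxeter_system W (@Dmat n)) (i j : Dnode n) : W :=
  (\prod_(k <- shortest_path (@Dadj n) i j) D k)%g.

Definition w_elt (n : nat) (W : finGroupType)
    (D : coxeter_system W (@Dmat n)) (i j : Dnode n) : W :=
  (s_elt D i (Dhat j) * longest D)%g.

(* Main.v *)
Require Import Defs.
From HB Require Import structures.
From mathcomp Require Import all_boot all_order all_algebra all_fingroup.
From mathcomp Require Import boolp ring zify.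

Set Implicit Arguments.
Unset Strict Implicit.
Unset Printing Implicit Defensive.

Import GRing.Theory.
Local Open Scope ring_scope.

(** Why the formula holds.

Write N for the length of the longest element w0, C_w for the
Kazhdan-Lusztig element of w, and C_s = H_s + v.  Fix a node t, and put
w_i = s_{it} w0 for every node i, where s_{it} is the product along the path
from i to t; these are the elements of one column of the penultimate cell,
t being the hatted second index.

The elements C_{w_i} together with C_{w0} span a left ideal (Cs_KC_cell).
Every node j other than i is a left descent of w_i, so H_j acts on C_{w_i} by
v^-1, while
  C_i C_{w_i} = (sum of the C_{w_j} over the neighbours j of i)
                + (C_{w0} if i = t).
So the ideal is the reflection representation extended by a line, and its
structure constants form the quantum Cartan matrix.

The polynomials are read off from multiplication by H_{w0}.  Taking the
coefficient of H_e is a trace form for which H_x and H_{x^-1} are dual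
(cf_trace), and w0 is an involution, so the coefficient of H_e in
H_{w0} C_{w_i} is the coefficient of H_{w0} in C_{w_i}, which is 0.
On the other hand, with k = N - 2n - 2,
  H_{w0} C_{w_i} = v^-k (- C_{w_i'} + d_i C_{w0})
where i' is the conjugate of i under w0 (longest_KC).  Since the coefficient of
H_e in C_{w0} is v^N, it follows that p_{e,w_i'} = d_i v^N (klp1_longest).

It remains to find d_i.  The element u = n...1 0^+ 0^- 1...n commutes with
every letter but n, up to the swap of 0^+ and 0^-; this forces
w0 = g u with lengths adding up, where g is a product of k letters different
from n (longest_fork).  The letters of u are applied to C_{w_n} one at a time,
which gives - C_{w_n} plus an explicit multiple of C_{w0} (H_rise_X); each
letter of g then only contributes a factor v^-1.  This is the case i = n.  As
w0 commutes with the nodes i >= 1, the relation above can be pushed down the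
path n, n-1, ..., 1 (longest_X): the d_i satisfy the recursion of the quantum
Cartan matrix, which is solved by quantum integers.  A braid relation transfers
the result from node 1 to the two fork nodes (longest_c0).

The facts needed about the Coxeter group itself (the longest element, and which
nodes can be left descents of a product) are also deduced from the
Kazhdan-Lusztig basis: if s is a left descent of w then H_s C_w = v^-1 C_w
(KC_eig), so the coefficients of C_w at y and at s y differ by a factor v,
and the only coefficient outside v Z[v] is the one at w. *)

(** * Laurent polynomials with positive powers of v *)

Lemma vLVK : vL * vLV = 1.
Proof. by apply: val_inj; rewrite /= mulfV // tofrac_eq0 polyX_eq0. Qed.

Lemma laurent_mulI (c a b : laurent) : c != 0 -> c * a = c * b -> a = b.
Proof.
move=> c0 /(congr1 laurent_val) /= E; apply: val_inj; apply: mulfI E.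
by apply: contraNneq c0 => E; apply/eqP/val_inj.
Qed.

Lemma vLX_sub a b : (b <= a)%N -> vL ^+ a * vLV ^+ b = vL ^+ (a - b).
Proof.
move=> le_ba; rewrite -{1}(subnK le_ba) exprD -mulrA -exprMn_comm ?vLVK.
  by rewrite expr1n mulr1.
exact: mulrC.
Qed.

Lemma vLX_neq0 k : vL ^+ k != 0.
Proof.
apply/eqP=> /(congr1 (fun x => vLV ^+ k * x)); rewrite mulr0 mulrC vLX_sub //.
by rewrite subnn => /eqP; rewrite oner_eq0.
Qed.

Lemma in_vZv0 : in_vZv 0.
Proof. by exists 0; rewrite mulr0 tofrac0. Qed.

Lemma in_vZvD x y : in_vZv x -> in_vZv y -> in_vZv (x + y).
Proof. by case=> q Ex [r Ey]; exists (q + r); rewrite /= Ex Ey mulrDr tofracD. Qed.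

Lemma in_vZvN x : in_vZv x -> in_vZv (- x).
Proof. by case=> q Ex; exists (- q); rewrite /= Ex mulrN tofracN. Qed.

Lemma in_vZvB x y : in_vZv x -> in_vZv y -> in_vZv (x - y).
Proof. by move=> hx hy; apply: in_vZvD => //; apply: in_vZvN. Qed.

Lemma in_vZvM x y : in_vZv x -> in_vZv y -> in_vZv (x * y).
Proof.
case=> q Ex [r Ey]; exists (q * 'X * r).
by rewrite /= Ex Ey -tofracM; congr tofrac; ring.
Qed.

Lemma in_vZv_v : in_vZv vL.
Proof. by exists 1; rewrite mulr1. Qed.

Lemma laurent_valZ (c : int) : laurent_val c%:~R = tofrac c%:~R.
Proof.
by rewrite [LHS](rmorph_int (val : {rmorphism laurent -> _})) [RHS]rmorph_int.
Qed.

Lemma in_vZv_intr (c : int) x : in_vZv x -> in_vZv (c%:~R * x).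
Proof.
case=> q Ex; exists (c%:~R * q).
by rewrite /= laurent_valZ Ex -tofracM; congr tofrac; ring.
Qed.

Lemma in_vZv_sum (I : Type) (r : seq I) (Q : pred I) (F : I -> laurent) :
  (forall i, Q i -> in_vZv (F i)) -> in_vZv (\sum_(i <- r | Q i) F i).
Proof. by move=> h; elim/big_ind: _ => //; [exact: in_vZv0 | exact: in_vZvD]. Qed.

Lemma in_vZv_neq1 : ~ in_vZv 1.
Proof.
case=> q /= /esym/eqP; rewrite -tofrac1 tofrac_eq => /eqP /(congr1 (horner^~ 0)).
by rewrite hornerM hornerX mul0r hornerC.
Qed.

(** The degree bound on Kazhdan-Lusztig coefficients is used through this
    lemma, to compare lengths. *)
Lemma in_vZv_vLVX k : ~ in_vZv (vLV ^+ k).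
Proof.
elim: k => [|k IHk] h; first exact: in_vZv_neq1.
by apply: IHk; move: (in_vZvM in_vZv_v h); rewrite exprS mulrA vLVK mul1r.
Qed.

(** Congruence modulo v Z[v] to an integer: x lies in Z[v] and has constant
    term c. *)
Definition cterm (x : laurent) (c : int) := in_vZv (x - c%:~R).

Lemma cterm0 x : in_vZv x -> cterm x 0.
Proof. by rewrite /cterm subr0. Qed.

Lemma ctermZ (c : int) : cterm c%:~R c.
Proof. by rewrite /cterm subrr; exact: in_vZv0. Qed.

Lemma cterm1 : cterm 1 1.
Proof. exact: (ctermZ 1). Qed.

Lemma ctermD x y a b : cterm x a -> cterm y b -> cterm (x + y) (a + b).
Proof.
move=> hx hy; rewrite /cterm (_ : _ - _ = (x - a%:~R) + (y - b%:~R)).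
  exact: in_vZvD.
by rewrite rmorphD /=; ring.
Qed.

Lemma cterm_v x a : cterm x a -> cterm (vL * x) 0.
Proof.
move=> hx; apply: cterm0; rewrite (_ : _ * _ = vL * (x - a%:~R) + a%:~R * vL).
  by apply: in_vZvD (in_vZv_intr _ in_vZv_v); apply: in_vZvM => //; exact: in_vZv_v.
by ring.
Qed.

(** The inclusion of Z[v] in Z[v, v^-1], written as an evaluation so that it is
    visibly multiplicative; it carries identities in v back to polynomials. *)
Definition laurent_of_poly (q : {poly int}) : laurent := (map_poly intr q).[vL].

Lemma laurent_of_polyE q : laurent_of_poly q = \sum_(i < size q) (q`_i)%:~R * vL ^+ i.
Proof.
rewrite /laurent_of_poly /map_poly horner_poly; by [].
Qed.

Lemma laurent_of_polyMXaddC q c :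
  laurent_of_poly (q * 'X + c%:P) = vL * laurent_of_poly q + c%:~R.
Proof.
by rewrite /laurent_of_poly rmorphD rmorphM /= map_polyX map_polyC /= hornerMXaddC mulrC.
Qed.

Lemma laurent_of_polyM q r :
  laurent_of_poly (q * r) = laurent_of_poly q * laurent_of_poly r.
Proof. by rewrite /laurent_of_poly rmorphM hornerM. Qed.

Lemma laurent_of_polyXn k : laurent_of_poly 'X^k = vL ^+ k.
Proof. by rewrite /laurent_of_poly rmorphXn /= map_polyX hornerXn. Qed.

Lemma laurent_val_of_poly q : laurent_val (laurent_of_poly q) = tofrac q.
Proof.
elim/poly_ind: q => [|q c IHq].
  by rewrite /laurent_of_poly rmorph0 horner0 /= tofrac0.
rewrite laurent_of_polyMXaddC /= IHq laurent_valZ -tofracM -tofracD.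
by congr tofrac; rewrite mulrC -[in RHS](intz c) rmorph_int.
Qed.

Lemma laurent_of_polyZ c : laurent_of_poly c%:~R = c%:~R.
Proof. by apply: val_inj; rewrite /= laurent_val_of_poly laurent_valZ. Qed.

Lemma laurent_of_poly_inj : injective laurent_of_poly.
Proof.
move=> q r /(congr1 laurent_val); rewrite !laurent_val_of_poly => /eqP.
by rewrite tofrac_eq => /eqP.
Qed.

Lemma in_vZvE x : in_vZv x -> exists q, x = vL * laurent_of_poly q.
Proof.
by case=> q Ex; exists q; apply: val_inj; rewrite /= Ex laurent_val_of_poly tofracM.
Qed.

Lemma cterm_vV x : in_vZv x -> exists c, cterm (vLV * x) c.
Proof.
case/in_vZvE=> q ->; elim/poly_ind: q => [|r c _].
  by exists 0; rewrite /laurent_of_poly rmorph0 horner0 !mulr0; apply/cterm0/in_vZv0.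
exists c; exists r; rewrite mulrA [vLV * _]mulrC vLVK mul1r.
rewrite laurent_of_polyMXaddC addrK /=.
by rewrite laurent_val_of_poly tofracM.
Qed.

(** A Laurent polynomial with only positive powers of v is not symmetric under
    the exchange of v and v^-1 unless it vanishes.  The algebra only provides
    bar on A, so the image x' of x under the exchange is exhibited through the
    scalars of A. *)
Lemma bar_in_vZv (A : algType laurent) (bar : {rmorphism A -> A}) x :
  bar vL%:A = vLV%:A -> in_vZv x ->
  exists2 x' : laurent, bar x%:A = x'%:A & (x = x' -> x = 0).
Proof.
move=> bar_v /in_vZvE[q Ex]; set d := size q.
exists (vLV * \sum_(i < d) (q`_i)%:~R * vLV ^+ i).
  rewrite Ex laurent_of_polyE.
  have E (y : laurent) : (y * \sum_(i < d) (q`_i)%:~R * y ^+ i)%:A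
      = y%:A * \sum_(i < d) (q`_i)%:~R * (y%:A ^+ i) :> A.
    rewrite -in_algE rmorphM rmorph_sum /=; congr (_ * _); apply: eq_bigr => i _.
    by rewrite -in_algE rmorphM rmorphXn rmorph_int.
  rewrite !E rmorphM rmorph_sum /= bar_v; congr (_ * _); apply: eq_bigr => i _.
  by rewrite rmorphM rmorphXn rmorph_int /= bar_v.
move=> Exx'.
(* Multiplying x = x' by v^(d+1) turns x' into a polynomial of degree at most
   d, whereas the left-hand side is divisible by v^(d+2). *)
have E : 'X^(d.+2) * q = \sum_(i < d) (q`_i)%:~R * 'X^(d - i).
  apply: laurent_of_poly_inj; rewrite laurent_of_polyM laurent_of_polyXn exprSr.
  rewrite -mulrA -Ex Exx' mulrA.
  rewrite /laurent_of_poly rmorph_sum horner_sum mulr_sumr /=; apply: eq_bigr => i _.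
  rewrite -/(laurent_of_poly _) laurent_of_polyM laurent_of_polyXn laurent_of_polyZ.
  rewrite mulrCA -mulrA -exprS vLX_sub ?subSS // ltnS.
  exact: ltnW (ltn_ord i).
suff q0 : q = 0 by rewrite Ex q0 /laurent_of_poly rmorph0 horner0 mulr0.
apply/polyP=> j; have /polyP/(_ (j + d.+2)%N) := E.
rewrite coefXnM ltnNge leq_addl addnK coef0 /= => ->.
rewrite coef_sum big1 // => i _.
rewrite mulrzl coefMrz coefXn gtn_eqF ?mul0rz //.
by rewrite -addSnnS (leq_trans _ (leq_addl _ _)) // ltnS leq_subr.
Qed.

(** * Length and left descents in a Coxeter group *)

Section CoxeterLength.

Local Open Scope group_scope.

Variables (W : finGroupType) (S : finType) (m : S -> S -> nat).
Variable D : coxeter_system W m.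

Definition word_elt (ws : seq S) : W := \prod_(s <- ws) D s.

Definition left_descent (s : S) (w : W) := (ell D (D s * w) < ell D w)%N.

Local Notation ldes := left_descent.

Lemma word_elt_cons s ws : word_elt (s :: ws) = D s * word_elt ws.
Proof. exact: big_cons. Qed.

Lemma word_elt_cat us ws : word_elt (us ++ ws) = word_elt us * word_elt ws.
Proof. exact: big_cat. Qed.

Lemma ell_le ws : (ell D (word_elt ws) <= size ws)%N.
Proof.
rewrite /ell; case: ex_minnP => k _; apply.
by apply/existsP; exists (in_tuple ws).
Qed.

Lemma reduced_exists w : exists ws, reduced_word D ws w.
Proof.
rewrite /reduced_word /ell; case: ex_minnP => k /existsP[t /eqP ->] _.
by exists t; split=> //; rewrite size_tuple.
Qed.

Lemma ell1 : ell D 1 = 0%N.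
Proof. by have := ell_le [::]; rewrite /word_elt big_nil leqn0 => /eqP. Qed.

Lemma ell_mul x y : (ell D (x * y) <= ell D x + ell D y)%N.
Proof.
have [us [Eu <-]] := reduced_exists x; have [ws [Ew <-]] := reduced_exists y.
by rewrite -Eu -Ew -size_cat -[_ * _]word_elt_cat ell_le.
Qed.

Lemma ell_simple_le s : (ell D (D s) <= 1)%N.
Proof. by have := ell_le [:: s]; rewrite /word_elt big_seq1. Qed.

Hypothesis m_diag : forall s, m s s = 1%N.

Lemma simpleK s : D s * D s = 1.
Proof. by have := simple_rel D s s; rewrite m_diag expg1. Qed.

Lemma mulKsimple s w : D s * (D s * w) = w.
Proof. by rewrite mulgA simpleK mul1g. Qed.

Lemma simpleV s : (D s)^-1 = D s.
Proof. by apply: (mulgI (D s)); rewrite mulgV simpleK. Qed.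

Lemma ell_inv w : ell D w^-1 = ell D w.
Proof.
have le_inv x : (ell D x^-1 <= ell D x)%N.
  have [ws [<- <-]] := reduced_exists x.
  rewrite (_ : _^-1 = word_elt (rev ws)) -?(size_rev ws) ?ell_le //.
  elim: ws => [|s ws IHws]; first by rewrite /word_elt /= !big_nil invg1.
  rewrite rev_cons -cats1 word_elt_cat -IHws big_cons invMg simpleV.
  by rewrite /word_elt big_seq1.
by apply/eqP; rewrite eqn_leq le_inv -{1}[w]invgK le_inv.
Qed.

(** The sign character exists by the universal property of the presentation. *)
Lemma ell_parity s w : odd (ell D (D s * w)) = ~~ odd (ell D w).
Proof.
pose t := tperm false true.
have tt : t * t = 1 by rewrite tperm2.
have rel s1 s2 : (t * t) ^+ m s1 s2 = 1 by rewrite tt expg1n.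
have [phi phiM phiD] := simple_univ D rel.
have phi1 : phi 1 = 1 by apply: (mulgI (phi 1)); rewrite -phiM !mulg1.
have phiE w' : phi w' = t ^+ odd (ell D w').
  have [ws [<- <-]] := reduced_exists w'.
  elim: ws => [|s' ws IHws]; first by rewrite big_nil.
  by rewrite big_cons phiM phiD IHws /=; case: (odd _); rewrite /= ?mulg1 ?tt.
have t_neq1 : t != 1.
  by apply/eqP=> /permP/(_ false); rewrite tpermL perm1.
have := phiM (D s) w; rewrite phiD !phiE.
by do 2!case: (odd _) => //=; rewrite ?expg1 ?expg0 ?mulg1 ?tt => /eqP;
  rewrite ?(negPf t_neq1) // eq_sym (negPf t_neq1).
Qed.

Lemma ldes_ell s w : ldes s w -> ell D w = (ell D (D s * w)).+1.
Proof.
rewrite /left_descent => lt_sw; apply/eqP; rewrite eqn_leq lt_sw andbT.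
have := ell_mul (D s) (D s * w); rewrite mulKsimple => /leq_trans-> //.
by rewrite -add1n leq_add2r ell_simple_le.
Qed.

Lemma nldes_ell s w : ~~ ldes s w -> ell D (D s * w) = (ell D w).+1.
Proof.
rewrite /left_descent -leqNgt => le_sw; apply/eqP; rewrite eqn_leq; apply/andP; split.
  apply: leq_trans (ell_mul _ _) _.
  by rewrite -add1n leq_add2r ell_simple_le.
rewrite ltn_neqAle le_sw andbT; apply/eqP=> E.
by have := ell_parity s w; rewrite -E; case: odd.
Qed.

Lemma ldesM s w : ldes s (D s * w) = ~~ ldes s w.
Proof.
have [h|h] := boolP (ldes s w); rewrite /left_descent mulKsimple.
  by rewrite (ldes_ell h) ltnNge leqnSn.
by rewrite (nldes_ell h) leqnn.
Qed.

Lemma ldes1 s : ldes s 1 = false.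
Proof. by rewrite /left_descent ell1. Qed.

Lemma ldes_exists w : w != 1 -> exists s, ldes s w.
Proof.
have [[|s ws] [<- sz]] := reduced_exists w; first by rewrite big_nil eqxx.
move=> _; exists s; rewrite /left_descent -sz big_cons mulKsimple ltnS.
exact: ell_le.
Qed.

Lemma bruhat_lt_ell x y : bruhat_lt D x y -> (ell D x < ell D y)%N.
Proof.
case/andP=> neq_xy /connectP[p step_p Ey]; move: neq_xy.
have le_path z q : path (bruhat_step D) z q -> (ell D z <= ell D (last z q))%N.
  elim: q z => //= z' q IHq z /andP[/andP[_ lt_z] /IHq]; apply: leq_trans.
  exact: ltnW.
rewrite {}Ey; case: p step_p => [|z p] /=; first by rewrite eqxx.
by case/andP=> /andP[_ lt_x] /le_path le_z _; apply: leq_trans le_z.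
Qed.

(** Removing a first letter of w is right multiplication by a reflection. *)
Lemma bruhat_lt1 w : w != 1 -> bruhat_lt D 1 w.
Proof.
move=> w1; rewrite /bruhat_lt eq_sym w1 /=.
have [k] := ubnP (ell D w); elim: k w {w1} => // k IHk w /ltnSE le_k.
have [-> | /ldes_exists[s ds]] := eqVneq w 1; first exact: connect0.
apply: (connect_trans (IHk (D s * w) (leq_trans ds le_k))).
apply: connect1; apply/andP; split=> //.
apply/existsP; exists (D s ^ (D s * w)); apply/andP; split.
  exact: imset2_f.
by rewrite conjgE !mulgA !mulgV mul1g simpleK mul1g.
Qed.

Lemma ell_simple s : ell D (D s) = 1%N.
Proof.
apply/eqP; rewrite eqn_leq ell_simple_le.
by have := ell_parity s 1; rewrite mulg1 ell1; case: (ell D (D s)).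
Qed.

End CoxeterLength.

(** * Coordinates in the standard basis *)

Section HeckeAlgebra.

Variables (W : finGroupType) (S : finType) (m : S -> S -> nat).
Variable D : coxeter_system W m.
Hypothesis m_diag : forall s, m s s = 1%N.
Variables (A : algType laurent) (Hs : S -> A) (H : W -> A).
Hypothesis hA : hecke_algebra D Hs H.

Definition Hcoef (a : A) : {ffun W -> laurent} := sval (cid (hecke_basis hA a)).

Local Notation cf := Hcoef.

Lemma cfE a : a = \sum_w cf a w *: H w.
Proof. by rewrite /Hcoef; case: cid => c []. Qed.

Lemma cf_sumH (c : W -> laurent) w : cf (\sum_y c y *: H y) w = c w.
Proof.
rewrite /Hcoef; case: cid => d [_ uniq_d] /=.
rewrite (uniq_d [ffun y => c y]) ?ffunE //.
by apply: eq_bigr => y _; rewrite ffunE.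
Qed.

Lemma cf_inj a b : (forall w, cf a w = cf b w) -> a = b.
Proof. by move=> E; rewrite [a]cfE [b]cfE; apply: eq_bigr => w _; rewrite E. Qed.

Lemma cfD a b w : cf (a + b) w = cf a w + cf b w.
Proof.
rewrite {1}[a]cfE {1}[b]cfE -big_split /=.
under eq_bigr do rewrite -scalerDl.
exact: (cf_sumH (fun y => cf a y + cf b y)).
Qed.

Lemma cfZ c a w : cf (c *: a) w = c * cf a w.
Proof.
rewrite {1}[a]cfE scaler_sumr.
under eq_bigr do rewrite scalerA.
exact: (cf_sumH (fun y => c * cf a y)).
Qed.

Lemma cf0 w : cf 0 w = 0.
Proof. by rewrite -(scale0r 0) cfZ mul0r. Qed.

Lemma cfN a w : cf (- a) w = - cf a w.
Proof. by rewrite -scaleN1r cfZ mulN1r. Qed.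

Lemma cfB a b w : cf (a - b) w = cf a w - cf b w.
Proof. by rewrite cfD cfN. Qed.

Lemma cf_sum (I : Type) (r : seq I) (Q : pred I) (F : I -> A) w :
  cf (\sum_(i <- r | Q i) F i) w = \sum_(i <- r | Q i) cf (F i) w.
Proof.
by elim/big_rec2: _ => [|i x y _ <-]; rewrite ?cf0 ?cfD.
Qed.

Lemma cfH w y : cf (H w) y = (y == w)%:R.
Proof.
have -> : H w = \sum_z (z == w)%:R *: H z.
  rewrite (bigD1 w) //= eqxx scale1r big1 ?addr0 // => z /negPf->.
  by rewrite scale0r.
exact: cf_sumH (fun z => (z == w)%:R) y.
Qed.

(** Reduces an identity in A to identities between coordinates. *)
Definition cfEE := (cfB, cfD, cfN, cfZ, cf0).

Lemma Hs_sq s : Hs s * Hs s = 1 + (vLV - vL) *: Hs s.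
Proof.
apply: subr0_eq; rewrite -(hecke_quad hA s) mulrDl !mulrBr.
rewrite mulr_algr !mulr_algl scalerA vLVK scalerBl scale1r.
rewrite !opprD !opprK !addrA; apply/eqP; rewrite -subr_eq0; apply/eqP.
by apply: cf_inj => w; rewrite !cfEE; ring.
Qed.

Lemma H1 : H 1%g = 1.
Proof.
rewrite (@hecke_std _ _ _ D A Hs H hA 1%g [::]) ?big_nil //.
by split; rewrite ?big_nil ?ell1.
Qed.

Lemma HsH_up s w : ~~ left_descent D s w -> Hs s * H w = H (D s * w)%g.
Proof.
move=> ds; have [ws [Ew sz]] := reduced_exists D w.
rewrite (@hecke_std _ _ _ D A Hs H hA w ws) //.
rewrite (@hecke_std _ _ _ D A Hs H hA (D s * w)%g (s :: ws)) ?big_cons //.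
by split; rewrite ?big_cons ?Ew //= sz nldes_ell.
Qed.

Lemma HHs_up s w : ell D (w * D s)%g = (ell D w).+1 -> H w * Hs s = H (w * D s)%g.
Proof.
move=> ds; have [ws [Ew sz]] := reduced_exists D w.
rewrite (@hecke_std _ _ _ D A Hs H hA w ws) //.
rewrite (@hecke_std _ _ _ D A Hs H hA (w * D s)%g (ws ++ [:: s])).
  by rewrite big_cat big_seq1.
by split; rewrite ?big_cat ?big_seq1 ?Ew //= size_cat sz ds addn1.
Qed.

Lemma HsH_down s w : left_descent D s w -> Hs s * H w = H (D s * w)%g + (vLV - vL) *: H w.
Proof.
move=> ds; have nds : ~~ left_descent D s (D s * w)%g by rewrite ldesM // negbK.
have Ew := HsH_up nds; rewrite mulKsimple // in Ew.
by rewrite -{1}Ew mulrA Hs_sq mulrDl mul1r -scalerAl Ew.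
Qed.

Lemma cf_Hs s h z :
  cf (Hs s * h) z = cf h (D s * z)%g + (left_descent D s z)%:R * (vLV - vL) * cf h z.
Proof.
have -> : Hs s * h =
    \sum_y (cf h (D s * y)%g + (left_descent D s y)%:R * (vLV - vL) * cf h y) *: H y.
  rewrite {1}[h]cfE mulr_sumr.
  under [RHS]eq_bigr do rewrite scalerDl.
  rewrite big_split /= [X in _ = X + _](reindex_inj (mulgI (D s))) /= -big_split.
  apply: eq_bigr => y _; rewrite mulKsimple // -scalerAr.
  have [ds | ds] := boolP (left_descent D s y).
    by rewrite HsH_down // scalerDr scalerA mul1r mulrC.
  by rewrite HsH_up //= !mul0r scale0r addr0.
exact: (cf_sumH (fun y =>
  cf h (D s * y)%g + (left_descent D s y)%:R * (vLV - vL) * cf h y)).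
Qed.

(** A last letter s of x is an ascent of the inverse of the remaining word, so
    the quadratic relation of H_s does not interfere with the coefficient
    extracted there; the letters of x can thus be moved over one by one. *)
Lemma cf_trace x h : cf (H x * h) 1%g = cf h x^-1%g.
Proof.
have [k] := ubnP (ell D x); elim: k x h => // k IHk x h /ltnSE le_k.
have [-> | x1] := eqVneq x 1%g; first by rewrite H1 mul1r invg1.
have [s] : exists s, left_descent D s x^-1%g.
  by apply: ldes_exists => //; rewrite -(inj_eq invg_inj) invg1 invgK.
move=> ds; have ell_sx := ldes_ell m_diag ds.
rewrite -[D s]simpleV // -invMg !ell_inv // in ell_sx.
have -> : H x = H (x * D s)%g * Hs s.
  by rewrite HHs_up // -mulgA simpleK // mulg1.
rewrite -mulrA IHk; last by rewrite -ltnS -ell_sx ltnS.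
rewrite cf_Hs invMg simpleV // mulKsimple //.
by rewrite ldesM // ds /= !mul0r addr0.
Qed.

End HeckeAlgebra.

(** * The Kazhdan-Lusztig basis and what it says about the group *)

Section KazhdanLusztig.

Variables (W : finGroupType) (S : finType) (m : S -> S -> nat).
Variable D : coxeter_system W m.
Hypothesis m_diag : forall s, m s s = 1%N.
Variables (A : algType laurent) (Hs : S -> A) (H : W -> A).
Hypothesis hA : hecke_algebra D Hs H.
Variable bar : {rmorphism A -> A}.
Hypothesis hbar : bar_involution Hs bar.
Variable p : W -> W -> laurent.
Hypothesis hp : KL_polynomials D H bar p.

Local Notation ldes := (left_descent D).
Local Notation l := (ell D).
Local Notation cf := (Hcoef hA).
Local Notation KC := (KL_element D H p).

Definition KLcoef (y w : W) : laurent := cf (KC w) y.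

Local Notation klp := KLcoef.

Definition Cs (s : S) : A := Hs s + vL%:A.

Lemma klpE y w : klp y w = (y == w)%:R + (bruhat_lt D y w)%:R * p y w.
Proof.
rewrite /KLcoef /KL_element cfD cfH; congr (_ + _).
rewrite cf_sum; under eq_bigr do rewrite cfZ cfH.
have [lt_yw | nlt_yw] := boolP (bruhat_lt D y w).
  rewrite (bigD1 y) //= eqxx mulr1 mul1r big1 ?addr0 // => z /andP[_].
  by rewrite eq_sym => /negPf->; rewrite mulr0.
rewrite mul0r big1 // => z lt_zw; case: eqP => [Eyz|]; last by rewrite mulr0.
by rewrite Eyz lt_zw in nlt_yw.
Qed.

Lemma bruhat_ltn y : bruhat_lt D y y = false.
Proof. by rewrite /bruhat_lt eqxx. Qed.

Lemma klp_diag w : klp w w = 1.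
Proof. by rewrite klpE eqxx bruhat_ltn mul0r addr0. Qed.

Lemma klp_p1 w : w != 1%g -> klp 1%g w = p 1%g w.
Proof. by move=> w1; rewrite klpE eq_sym (negPf w1) bruhat_lt1 // add0r mul1r. Qed.

Lemma klp_vZv y w : y != w -> in_vZv (klp y w).
Proof.
move=> neq_yw; rewrite klpE (negPf neq_yw) add0r.
case: (boolP (bruhat_lt D y w)) => [lt_yw | _]; last by rewrite mul0r; apply: in_vZv0.
by rewrite mul1r; apply: (hp w).2.
Qed.

Lemma klp_eq0 y w : y != w -> (l w <= l y)%N -> klp y w = 0.
Proof.
move=> neq_yw le_wy; rewrite klpE (negPf neq_yw) add0r.
case: (boolP (bruhat_lt D y w)) => [/(bruhat_lt_ell)|_]; last by rewrite mul0r.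
by rewrite ltnNge le_wy.
Qed.

Lemma klp_cterm y w : cterm (klp y w) (y == w)%:R.
Proof.
case: eqP => [-> | /eqP neq_yw]; first by rewrite klp_diag; apply: cterm1.
by apply: cterm0; apply: klp_vZv.
Qed.

Lemma klp_eq1 y w : klp y w = 1 -> y = w.
Proof.
by move=> E; apply/eqP; apply: contraPT isT => /klp_vZv; rewrite E => /in_vZv_neq1.
Qed.

Lemma KC_bar w : bar (KC w) = KC w.
Proof. exact: (hp w).1. Qed.

Lemma KC_free (d : W -> laurent) : \sum_y d y *: KC y = 0 -> forall y, d y = 0.
Proof.
move=> E y; apply/eqP/negPn/negP => dy0.
pose z := [arg max_(z > y | d z != 0) l z].
have [dz0 max_z] : d z != 0 /\ forall x, d x != 0 -> (l x <= l z)%N.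
  by rewrite /z; case: arg_maxnP => // z' dz' max_z'.
have := congr1 (fun a => cf a z) E; rewrite cf_sum cf0 (bigD1 z) //= big1.
  by rewrite cfZ -/(klp z z) klp_diag mulr1 addr0 => /eqP; rewrite (negPf dz0).
move=> x neq_xz; rewrite cfZ -/(klp z x).
have [-> | dx0] := eqVneq (d x) 0; first by rewrite mul0r.
by rewrite klp_eq0 ?mulr0 ?max_z // eq_sym.
Qed.

(** The C_y are unitriangular over Z[v] with respect to length, so coordinates in
    v Z[v] are preserved when the terms of top length are peeled off. *)
Lemma KC_expand k h : (forall y, in_vZv (cf h y)) ->
    (forall y, (k <= l y)%N -> cf h y = 0) ->
  exists2 d : W -> laurent, forall y, in_vZv (d y) & h = \sum_y d y *: KC y.
Proof.
elim: k h => [|k IHk] h vh h0.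
  exists (fun=> 0) => [y|]; first exact: in_vZv0.
  rewrite big1 => [|y _]; last by rewrite scale0r.
  by apply: (cf_inj (hA := hA)) => w; rewrite cf0 h0.
pose e y := (l y == k)%:R * cf h y.
have ve y : in_vZv (e y).
  by rewrite /e; case: eqP; rewrite ?mul1r ?mul0r // => _; apply: in_vZv0.
have [y|y le_ky|d vd Ed] := IHk (h - \sum_y e y *: KC y).
- rewrite cfB; apply: in_vZvB => //; rewrite cf_sum; apply: in_vZv_sum => z _.
  rewrite cfZ -/(klp y z); have [-> | ?] := eqVneq y z.
    by rewrite klp_diag mulr1.
  by apply: in_vZvM => //; apply: klp_vZv.
- rewrite cfB cf_sum (bigD1 y) //= cfZ -/(klp y y) klp_diag mulr1 big1.
    rewrite addr0 /e; case: ltngtP le_ky => // [lt_ky _ | _ _].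
      by rewrite mul0r subr0 h0.
    by rewrite mul1r subrr.
  move=> z neq_zy; rewrite cfZ -/(klp y z) /e.
  case: eqP => [Ez|]; last by rewrite !mul0r.
  by rewrite klp_eq0 ?mulr0 ?Ez // eq_sym.
exists (fun y => d y + e y) => [y|]; first exact: in_vZvD.
under eq_bigr do rewrite scalerDl.
by rewrite big_split /= -Ed subrK.
Qed.

(** The coordinates of h in the basis of the C_y are invariant under the exchange
    of v and v^-1, because h and the C_y are bar-invariant; being in v Z[v], they
    vanish. *)
Lemma KC_unique h : bar h = h -> (forall y, in_vZv (cf h y)) -> h = 0.
Proof.
move=> bar_h vh; pose k := (\max_y l y).+1.
have [y le_ky|d vd Eh] := KC_expand (k := k) vh.
  by have := leq_bigmax (F := fun y => l y) y; rewrite leqNgt -/k le_ky.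
have d'P y := bar_in_vZv (bar_v hbar) (vd y).
pose d' y := s2val (cid2 (d'P y)).
have d'E y : bar (d y)%:A = (d' y)%:A by rewrite /d'; case: cid2.
have dd' y : d y = d' y -> d y = 0 by rewrite /d'; case: cid2.
have Eh' : h = \sum_y d' y *: KC y.
  rewrite -{1}bar_h Eh rmorph_sum /=; apply: eq_bigr => y _.
  by rewrite -mulr_algl rmorphM /= d'E KC_bar mulr_algl.
have E : \sum_y (d y - d' y) *: KC y = 0.
  by under eq_bigr do rewrite scalerBl; rewrite sumrB -Eh -Eh' subrr.
rewrite Eh big1 // => y _; rewrite dd' ?scale0r //.
by apply/eqP; rewrite -subr_eq0 (KC_free E).
Qed.

(** The only tool for computing products in this basis: a bar-invariant element
    over Z[v] is determined by its constant terms. *)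
Lemma KC_unique_expand h (c : W -> int) :
    bar h = h -> (forall y, cterm (cf h y) (c y)) ->
  h = \sum_y (c y)%:~R *: KC y.
Proof.
move=> bar_h ch; apply/eqP; rewrite -subr_eq0; apply/eqP; apply: KC_unique.
  rewrite rmorphB rmorph_sum /= bar_h; congr (_ - _); apply: eq_bigr => y _.
  by rewrite !scaler_int rmorphMz /= KC_bar.
move=> y; rewrite cfB cf_sum (bigD1 y) //= cfZ -/(klp y y) klp_diag mulr1 opprD addrA.
apply: in_vZvB; first exact: ch.
apply: in_vZv_sum => z neq_zy; rewrite cfZ; apply: in_vZv_intr.
by apply: klp_vZv; rewrite eq_sym.
Qed.

Lemma bar_Cs s : bar (Cs s) = Cs s.
Proof.
have [E _] := bar_Hs hbar s.
have inv_Hs : Hs s * (Hs s + (vL - vLV)%:A) = 1.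
  rewrite mulrDr (Hs_sq hA) mulr_algr.
  by apply: (cf_inj (hA := hA)) => w; rewrite !cfEE; ring.
have bE : bar (Hs s) = Hs s + (vL - vLV)%:A.
  by rewrite -[LHS]mulr1 -[X in _ * X = _]inv_Hs mulrA E mul1r.
by rewrite /Cs rmorphD /= bE (bar_v hbar) scalerBl addrA subrK.
Qed.

Lemma Hs_Cs s : Hs s * Cs s = vLV *: Cs s.
Proof.
rewrite /Cs mulrDr (Hs_sq hA) mulr_algr; apply: (cf_inj (hA := hA)) => w.
by rewrite !cfEE; ring: vLVK.
Qed.

Lemma cf_Cs s h z : cf (Cs s * h) z =
  cf h (D s * z)%g + (if ldes s z then vLV else vL) * cf h z.
Proof.
by rewrite /Cs mulrDl cfD cf_Hs // mulr_algl cfZ; case: ldes => /=; ring.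
Qed.

Definition eig s h := Hs s * h = vLV *: h.

Lemma eig_Cs s h : eig s (Cs s * h).
Proof. by rewrite /eig mulrA Hs_Cs scalerAl. Qed.

Lemma eigD s a b : eig s a -> eig s b -> eig s (a + b).
Proof. by rewrite /eig mulrDr scalerDr => -> ->. Qed.

Lemma eigZ s c a : eig s a -> eig s (c *: a).
Proof. by rewrite /eig -scalerAr => ->; rewrite !scalerA mulrC. Qed.

Lemma eigN s a : eig s a -> eig s (- a).
Proof. by rewrite -scaleN1r; apply: eigZ. Qed.

Lemma eig_sum s (I : Type) (r : seq I) (Q : pred I) (F : I -> A) :
  (forall i, Q i -> eig s (F i)) -> eig s (\sum_(i <- r | Q i) F i).
Proof.
move=> h; elim/big_ind: _ => //; last exact: eigD.
by rewrite /eig mulr0 scaler0.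
Qed.

Lemma eig_cf s h z : eig s h -> ~~ ldes s z -> cf h z = vL * cf h (D s * z)%g.
Proof.
move=> /(congr1 (fun a => cf a z)); rewrite cf_Hs // cfZ => E /negPf nds.
by rewrite nds !mul0r addr0 in E; rewrite E mulrA vLVK mul1r.
Qed.

(** Away from the top element s w, the constant term of C_s C_w comes from
    v^-1 p_{y,w} alone, and only when s is a left descent of y. *)
Lemma cterm_Cs_KC s w y c : ~~ ldes s w -> y != (D s * w)%g ->
  (ldes s y -> cterm (vLV * klp y w) c) -> (~~ ldes s y -> c = 0) ->
  cterm (cf (Cs s * KC w) y) c.
Proof.
move=> nds neq_y cd cn; rewrite cf_Cs -!/(klp _ _) -[c]add0r; apply: ctermD.
  apply/cterm0/klp_vZv; apply: contraNneq neq_y => <-.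
  by rewrite mulKsimple.
case: ifP => ds; first exact: cd.
rewrite cn ?ds //; apply: cterm_v; exact: klp_cterm.
Qed.

Lemma cterm_Cs_KC_top s w : ~~ ldes s w -> cterm (cf (Cs s * KC w) (D s * w)%g) 1.
Proof.
move=> nds; rewrite cf_Cs -!/(klp _ _) mulKsimple // klp_diag.
rewrite ldesM // nds klp_eq0 ?mulr0 ?addr0; first exact: cterm1.
  by apply/eqP=> E; have := ldesM D m_diag s w; rewrite E; case: (ldes s w).
by rewrite nldes_ell.
Qed.

Lemma bar_Cs_KC s w : bar (Cs s * KC w) = Cs s * KC w.
Proof. by rewrite rmorphM /= bar_Cs KC_bar. Qed.

(** With w' = s w shorter than w, the product C_s C_{w'} is C_w plus
    a combination of C_y with y shorter than w and s a left descent of y; H_s acts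
    by v^-1 on the product, and on these C_y by induction. *)
Lemma KC_eig s w : ldes s w -> eig s (KC w).
Proof.
have [k] := ubnP (l w); elim: k s w => // k IHk s w /ltnSE le_k ds.
pose w' := (D s * w)%g.
have ds' : ~~ ldes s w' by rewrite ldesM // negbK.
have Ew : (D s * w')%g = w by rewrite mulKsimple.
have /choice[c cP] y : exists c : int, [/\ cterm (cf (Cs s * KC w') y) c,
    y = w -> c = 1 & y != w -> c != 0 -> ldes s y && (l y < l w)%N].
  have [->|/eqP neq_yw] := eqVneq y w.
    by exists 1; split=> //; rewrite ?eqxx // -Ew; apply: cterm_Cs_KC_top.
  have neq_y := introN eqP neq_yw; have [dsy | ndsy] := boolP (ldes s y); last first.
    by exists 0; split; rewrite ?eqxx //; apply: cterm_Cs_KC; rewrite ?Ew // (negPf ndsy).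
  have neq_y' : y != w' by apply: contraTneq dsy => ->.
  have [c cP] := cterm_vV (klp_vZv neq_y').
  have [le_y | lt_y] := leqP (l w') (l y).
    exists 0; split; rewrite ?eqxx //; apply: cterm_Cs_KC => // [|_]; first by rewrite Ew.
    by rewrite klp_eq0 // mulr0; apply/cterm0/in_vZv0.
  exists c; split=> [|/neq_yw //|_ _]; first by apply: cterm_Cs_KC; rewrite ?Ew ?dsy.
  exact: ltn_trans lt_y ds.
have E : Cs s * KC w' = \sum_y (c y)%:~R *: KC y.
  by apply: KC_unique_expand (bar_Cs_KC s w') _ => y; case: (cP y).
have -> : KC w = Cs s * KC w' - \sum_(y | y != w) (c y)%:~R *: KC y.
  rewrite E (bigD1 w) //=; have [_ -> // _] := cP w.
  by rewrite scale1r addrK.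
apply: eigD; first exact: eig_Cs.
apply/eigN/eig_sum => y neq_y; have [_ _ /(_ neq_y)] := cP y.
have [-> _|_ /(_ isT)/andP[dsy lt_y]] := eqVneq (c y) 0.
  by rewrite /eig scale0r mulr0 scaler0.
by apply/eigZ/IHk => //; apply: leq_trans lt_y le_k.
Qed.

Lemma klp_descent s y w : ldes s w -> ~~ ldes s y -> klp y w = vL * klp (D s * y)%g w.
Proof. by move/KC_eig => eig_w nds; apply: eig_cf. Qed.

(** If every node is a left descent of z, then C_z is an eigenvector of
    all the H_s, and such eigenvectors are determined by their coefficient at 1. *)
Lemma klp_full z x : (forall s, ldes s z) -> klp x z = vL ^+ l z * vLV ^+ l x.
Proof.
move=> full_z.
have klpE1 y : klp y z = vLV ^+ l y * klp 1%g z.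
  have [k] := ubnP (l y); elim: k y => // k IHk y /ltnSE le_k.
  have [-> | y1] := eqVneq y 1%g; first by rewrite ell1 mul1r.
  have [s ds] := ldes_exists D m_diag y1.
  rewrite (ldes_ell m_diag ds) exprS -mulrA -IHk ?(leq_trans ds) //.
  rewrite (@klp_descent s (D s * y)%g) ?ldesM ?ds //.
  by rewrite mulrA [vLV * _]mulrC vLVK mul1r mulKsimple.
rewrite klpE1 mulrC; congr (_ * _).
apply: (@laurent_mulI (vLV ^+ l z)); last by rewrite -klpE1 klp_diag mulrC vLX_sub ?subnn.
apply/eqP=> E; have := vLX_sub (leqnn (l z)); rewrite E mulr0 subnn => /esym/eqP.
by rewrite oner_eq0.
Qed.

(** Otherwise the coefficient of C_z at x would be a nonpositive power of v. *)
Lemma ell_full z x : (forall s, ldes s z) -> x != z -> (l x < l z)%N.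
Proof.
move=> full_z /klp_vZv; rewrite klp_full // ltnNge => h; apply/negP=> le_zx.
apply: (@in_vZv_vLVX (l x - l z)).
suff -> : vLV ^+ (l x - l z) = vL ^+ l z * vLV ^+ l x by [].
by rewrite -{2}(subnKC le_zx) exprD mulrA vLX_sub // subnn mul1r.
Qed.

Local Notation w0 := (longest D).

Lemma longest_max x : (l x <= l w0)%N.
Proof. by rewrite /longest; case: arg_maxnP => // z _; apply. Qed.

Lemma longest_full s : ldes s w0.
Proof.
apply/negPn/negP=> /nldes_ell E.
by have := longest_max (D s * w0)%g; rewrite E ltnn.
Qed.

Lemma full_longest z : (forall s, ldes s z) -> z = w0.
Proof.
move=> full_z; apply/eqP/negPn/negP; rewrite eq_sym => /(ell_full full_z).
by rewrite ltnNge longest_max.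
Qed.

Lemma max_longest z : l z = l w0 -> z = w0.
Proof.
by move=> E; apply/eqP/negPn/negP => /(ell_full longest_full); rewrite E ltnn.
Qed.

Lemma longestV : (w0^-1)%g = w0.
Proof. by apply: max_longest; rewrite ell_inv. Qed.

Lemma longestK : (w0 * w0)%g = 1%g.
Proof. by rewrite -{2}longestV mulgV. Qed.

(** Right ascents can be appended to x as long as there are any; the process stops
    at an element having every node as a right descent, that is, at w0. *)
Lemma longest_extend x : exists y, w0 = (x * y)%g /\ l w0 = (l x + l y)%N.
Proof.
have [k] := ubnP (l w0 - l x); elim: k x => // k IHk x /ltnSE le_k.
have [full | /existsNP[s nds]] := pselect (forall s, ldes s (x^-1)%g).
  exists 1%g; rewrite ell1 addn0 mulg1; suff -> : x = w0 by [].
  by rewrite -[x]invgK (full_longest full) longestV.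
have E : l (x * D s)%g = (l x).+1.
  by rewrite -ell_inv // invMg simpleV // nldes_ell ?ell_inv //; apply/negP.
have le_xs := longest_max (x * D s)%g.
have [|y [Ew El]] := IHk (x * D s)%g; first by rewrite E in le_xs *; lia.
exists (D s * y)%g; split; first by rewrite Ew mulgA.
have := ell_mul D (D s) y; have := ell_mul D x (D s * y)%g.
rewrite mulgA -Ew ell_simple // El E; lia.
Qed.

Lemma ell_mul_longest x : l (x * w0)%g = (l w0 - l x)%N.
Proof.
have [y [Ey El]] := longest_extend (x^-1)%g.
by rewrite {1}Ey mulgA mulgV mul1g El ell_inv // addKn.
Qed.

Lemma ell_longest_mul x : l (w0 * x)%g = (l w0 - l x)%N.
Proof. by rewrite -ell_inv // invMg longestV ell_mul_longest ell_inv. Qed.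

Lemma ldes_mul_longest s x : ldes s (x * w0)%g = ~~ ldes s x.
Proof.
have := ell_parity D s x; have := longest_max x; have := longest_max (D s * x)%g.
rewrite /left_descent mulgA !ell_mul_longest => h1 h2 h3.
have : l (D s * x)%g <> l x by move=> E; rewrite E in h3; case: odd h3.
move: h1 h2; move: (l _) (l _) (l _) => a b c le_b le_c neq.
by rewrite -leqNgt; apply/idP/idP; lia.
Qed.

(** By the two length formulas above, w0 s w0 has length 1. *)
Lemma longest_conj s : exists s', (D s' * w0 = w0 * D s)%g.
Proof.
have El : l (w0 * D s * w0)%g = 1%N.
  rewrite ell_mul_longest ell_longest_mul ell_simple.
  have := longest_max (D s); rewrite ell_simple; lia.
have [ws [Ex sz]] := reduced_exists D (w0 * D s * w0)%g; rewrite El in sz.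
case: ws Ex sz => [|s' []] // Ex _.
exists s'; rewrite big_seq1 in Ex; rewrite Ex -mulgA longestK.
by rewrite mulg1.
Qed.

Lemma H_longest_conj s s' : (D s' * w0 = w0 * D s)%g -> H w0 * Hs s = Hs s' * H w0.
Proof.
move=> E; have ds' := longest_full s'.
have nds' : ~~ ldes s' (D s' * w0)%g by rewrite ldesM // ds'.
have E1 := HsH_up hA nds'; rewrite mulKsimple // in E1.
have E2 : H (w0 * D s)%g * Hs s = H w0.
  rewrite (HHs_up hA) -?mulgA ?simpleK ?mulg1 //.
  by rewrite -E (ldes_ell m_diag ds').
by rewrite -[in RHS]E2 mulrA -E E1.
Qed.

Lemma longest_conj_sym s s' : (D s' * w0 = w0 * D s)%g -> (D s * w0 = w0 * D s')%g.
Proof.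
move=> E; apply: (mulgI w0); rewrite [RHS]mulgA longestK mul1g mulgA -E -mulgA.
by rewrite longestK mulg1.
Qed.

(** The coefficient of C_x at i x is v.  If k were an ascent of i x, the
    coefficient at k i x would be 1, forcing k i x = x. *)
Lemma ldes_simple2 i k x : D i != D k -> ldes i x -> ldes k x -> ldes k (D i * x)%g.
Proof.
move=> neq_ik di dk; apply/negPn/negP=> ndk.
have E1 : klp (D i * x)%g x = vL.
  by rewrite (@klp_descent i) ?ldesM ?di // mulKsimple // klp_diag mulr1.
have := klp_descent dk ndk; rewrite E1 -[LHS]mulr1.
move/(laurent_mulI (vLX_neq0 1))/esym/klp_eq1.
rewrite mulgA -[X in _ = X]mul1g => /mulIg E; move/eqP: neq_ik; apply.
by apply: (mulgI (D k)); rewrite E simpleK.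
Qed.

(** If i were an ascent of k i x, then y = i k i x = k i k x would have both
    i and k as left descents, and the previous lemma applied to y would make k
    a left descent of i y = k i x, although i x = k (k i x) is longer. *)
Lemma ldes_simple3 i k x : D i != D k -> (D i * (D k * D i) = D k * (D i * D k))%g ->
  ldes i x -> ldes k x -> ldes i (D k * (D i * x))%g.
Proof.
move=> neq_ik braid di dk; apply/negPn/negP=> ndi.
pose y := (D i * (D k * (D i * x)))%g.
have Ey : y = (D k * (D i * (D k * x)))%g.
  by rewrite /y mulgA mulgA -[(D i * _ * _)%g]mulgA braid !mulgA.
have dki := ldes_simple2 neq_ik di dk.
have neq_ki : D k != D i by rewrite eq_sym.
have dik := ldes_simple2 neq_ki dk di.
have diy : ldes i y by rewrite ldesM.
have dky : ldes k y.
  rewrite /left_descent {1}Ey mulKsimple // /y (nldes_ell ndi).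
  have := ldes_ell m_diag dik; have := ldes_ell m_diag dki.
  by have := ldes_ell m_diag di; have := ldes_ell m_diag dk; lia.
have := ldes_simple2 neq_ik diy dky; rewrite mulKsimple // ldesM //.
by rewrite dki.
Qed.

(** The two rank-two lemmas, read for a product i x with i an ascent of x.  This is
    how the left descents of long words are controlled below. *)
Lemma ldes_mul i k x : ~~ ldes i x -> ldes k (D i * x)%g -> D i != D k ->
  ldes k x /\ ((D i * (D k * D i) = D k * (D i * D k))%g -> ldes i (D k * x)%g).
Proof.
move=> ndi dk neq_ik; have di : ldes i (D i * x)%g by rewrite ldesM.
split=> [|braid].
  by have := ldes_simple2 neq_ik di dk; rewrite mulKsimple.
by have := ldes_simple3 neq_ik braid di dk; rewrite mulKsimple.
Qed.

(** A term C_y of C_i C_w with y shorter than w has i as a left descent.  If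
    some left descent k of w is missing from y, then p_{y,w} = v p_{ky,w} can
    contribute only when k y = w.  If none is missing, every node is a left descent
    of y, so y is the longest element and does not occur in C_w. *)
Lemma Cs_KC_codim1 i w : injective D ->
  ~~ ldes i w -> (forall k, k != i -> ldes k w) ->
  Cs i * KC w = KC (D i * w)%g +
    \sum_(k | (k != i) && ldes i (D k * w)%g) KC (D k * w)%g.
Proof.
move=> Dinj ndi dw.
pose Q y := ldes i y && [exists k, (k != i) && ((D k * w)%g == y)].
have neq_top k : k != i -> (D k * w)%g != (D i * w)%g.
  by move=> ki; rewrite (inj_eq (mulIg _)) (inj_eq Dinj).
rewrite (KC_unique_expand (h := Cs i * KC w)
  (c := fun y => (y == (D i * w)%g)%:R + (Q y)%:R)) ?bar_Cs_KC //.
  under eq_bigr do rewrite rmorphD scalerDl.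
  rewrite big_split /=; congr (_ + _).
    rewrite (bigD1 (D i * w)%g) //= eqxx scale1r big1 ?addr0 // => y /negPf->.
    exact: scale0r.
  rewrite (bigID Q) /= [X in _ + X]big1 ?addr0 => [|y /negPf->]; last exact: scale0r.
  rewrite -[RHS](big_imset (h := fun k => (D k * w)%g) KC) /=; last first.
    by move=> k1 k2 _ _ /mulIg/Dinj.
  apply: eq_big => [y|y ->]; last exact: scale1r.
  apply/andP/imsetP => [[dy /existsP[k /andP[ki /eqP Ey]]]|[k]].
    by exists k; rewrite ?Ey // unfold_in ki Ey dy.
  rewrite unfold_in => /andP[ki dk] ->; split=> //.
  by apply/existsP; exists k; rewrite ki eqxx.
move=> y; have [-> | neq_y] := eqVneq y (D i * w)%g.
  rewrite (_ : Q _ = false) ?addr0; first exact: cterm_Cs_KC_top.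
  apply/negP=> /andP[_ /existsP[k /andP[ki]]]; exact/negP/neq_top.
rewrite add0r; apply: cterm_Cs_KC => // [di | ndiy]; last by rewrite /Q (negPf ndiy).
have neq_yw : y != w by apply: contraNneq ndi => <-.
have klpV k : ldes k w -> ~~ ldes k y -> vLV * klp y w = klp (D k * y)%g w.
  by move=> dk ndk; rewrite (klp_descent dk ndk) mulrA [vLV * _]mulrC vLVK mul1r.
rewrite /Q di /=; case: existsP => [[k /andP[ki /eqP Ey]] | noQ].
  rewrite (klpV k (dw k ki)); last by rewrite -Ey ldesM // negbK dw.
  by rewrite -Ey mulKsimple // klp_diag; apply: cterm1.
have [full | /existsNP[k /negP ndk]] := pselect (forall s, ldes s y).
  rewrite klp_eq0 ?mulr0 //; first exact/cterm0/in_vZv0.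
  by rewrite (full_longest full) longest_max.
have ki : k != i by apply: contraNneq ndk => ->.
rewrite (klpV k (dw k ki) ndk); apply/cterm0/klp_vZv; apply/eqP => E; case: noQ.
by exists k; rewrite ki -E mulKsimple ?eqxx.
Qed.

End KazhdanLusztig.

(** * Signed permutations: the simple reflections are distinct *)

Section SignedPermutations.

Variable n : nat.

Definition adjswap (k a : nat) : nat :=
  if a == k then k.+1 else if a == k.+1 then k else a.

(** The standard reflections of type D on signed letters, a boolean recording
    the sign: Some k exchanges the letters k and k+1, and None exchanges the
    letters 0 and 1 while changing both signs.  Letters are natural numbers here,
    so that the Coxeter relations become arithmetic. *)
Definition refl_fun (s : Dnode n) (x : bool * nat) : bool * nat :=
  match s with
  | Some k => (x.1, adjswap k x.2)
  | None => (x.1 (+) (x.2 == 0%N) (+) (x.2 == 1%N), adjswap 0%N x.2)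
  end.

(* A comparison of letters is decided once its two sides no longer contain
   conditionals, so nested conditionals reduce from the inside out. *)
Ltac decide_eq := repeat match goal with
  | |- context [?x == ?y :> nat] =>
    first [ rewrite (_ : (x == y) = true); last by apply/eqP; lia
          | rewrite (_ : (x == y) = false); last by apply/eqP; lia ]; cbn iota beta
  end.

Lemma refl_funK s : involutive (refl_fun s).
Proof.
have E k a : (a = k \/ a = k.+1) \/ (a <> k /\ a <> k.+1) by lia.
case: s => [k|] [b a] /=; rewrite /adjswap.
  by have [[->|->]|[? ?]] := E k a; congr (_, _); decide_eq.
by have [[->|->]|[? ?]] := E 0%N a; case: b; congr (_, _); decide_eq.
Qed.

Lemma refl_fun_rel s t x :
  iter (Dmat s t) (fun z => refl_fun t (refl_fun s z)) x = x.
Proof.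
rewrite /Dmat; case: eqP => [-> | neq_st] /=; first exact: refl_funK.
case: s t x neq_st => [k|] [l|] // [b a] neq_st.
- have neq_kl : nat_of_ord k <> l by move=> E; apply: neq_st; congr Some; apply: val_inj.
  rewrite /Dadj; case: ifP => adj; rewrite /= /adjswap.
    have : a = k \/ a = k.+1 \/ a = l \/ a = l.+1 \/
           (a <> k /\ a <> k.+1 /\ a <> l /\ a <> l.+1) by lia.
    by move: (nat_of_ord k) (nat_of_ord l) neq_kl adj => {neq_st}k' l' neq_kl;
      case/orP=> /eqP<-; case=> [->|[->|[->|[->|[? [? [? ?]]]]]]]; congr (_, _); decide_eq.
  have : a = k \/ a = k.+1 \/ a = l \/ a = l.+1 \/
         (a <> k /\ a <> k.+1 /\ a <> l /\ a <> l.+1) by lia.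
  by move: (nat_of_ord k) (nat_of_ord l) neq_kl adj => {neq_st}k' l' neq_kl adj;
    case=> [->|[->|[->|[->|[? [? [? ?]]]]]]]; congr (_, _); decide_eq.
- have : a = 0%N \/ a = 1%N \/ a = k \/ a = k.+1 \/
         (a <> k /\ a <> k.+1 /\ a <> 0%N /\ a <> 1%N) by lia.
  rewrite /Dadj; case: ifP => adj; rewrite /= /adjswap;
    move: (nat_of_ord k) adj => {neq_st}k' adj.
    by move/eqP: adj => ->;
      case=> [->|[->|[->|[->|[? [? [? ?]]]]]]]; case: b; congr (_, _); decide_eq.
  have [-> | [k'' ->]] : k' = 0%N \/ exists k'', k' = k''.+2.
    - by case: k' adj => [|[|k'']] // _; [left | right; exists k''].
    by case=> [->|[->|[->|[->|[? [? [? ?]]]]]]]; case: b; congr (_, _); decide_eq.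
  by case=> [->|[->|[->|[->|[? [? [? ?]]]]]]]; case: b; congr (_, _); decide_eq.
- have : a = 0%N \/ a = 1%N \/ a = l \/ a = l.+1 \/
         (a <> l /\ a <> l.+1 /\ a <> 0%N /\ a <> 1%N) by lia.
  rewrite /Dadj; case: ifP => adj; rewrite /= /adjswap;
    move: (nat_of_ord l) adj => {neq_st}k' adj.
    by move/eqP: adj => ->;
      case=> [->|[->|[->|[->|[? [? [? ?]]]]]]]; case: b; congr (_, _); decide_eq.
  have [-> | [k'' ->]] : k' = 0%N \/ exists k'', k' = k''.+2.
    - by case: k' adj => [|[|k'']] // _; [left | right; exists k''].
    by case=> [->|[->|[->|[->|[? [? [? ?]]]]]]]; case: b; congr (_, _); decide_eq.
  by case=> [->|[->|[->|[->|[? [? [? ?]]]]]]]; case: b; congr (_, _); decide_eq.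
Qed.

Definition signed_pt (x : bool * 'I_n.+2) : bool * nat := (x.1, x.2 : nat).

Definition signed_refl (s : Dnode n) (x : bool * 'I_n.+2) : bool * 'I_n.+2 :=
  let y := refl_fun s (signed_pt x) in (y.1, inord y.2).

Lemma signed_pt_inj : injective signed_pt.
Proof. by move=> [b a] [b' a'] [-> /val_inj->]. Qed.

Lemma signed_reflE s x : signed_pt (signed_refl s x) = refl_fun s (signed_pt x).
Proof.
suff lt_y : ((refl_fun s (signed_pt x)).2 < n.+2)%N.
  by rewrite /signed_refl {1}/signed_pt /= inordK //; case: refl_fun.
case: x s => b [a lt_a] [[k lt_k]|] /=; rewrite /adjswap;
  do 2?case: ifP => // _; exact: ltnW.
Qed.

Lemma signed_refl_inj s : injective (signed_refl s).
Proof.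
apply: inv_inj => x; apply: signed_pt_inj.
by rewrite !signed_reflE refl_funK.
Qed.

Definition signed_perm s : {perm bool * 'I_n.+2} := perm (@signed_refl_inj s).

(** The images of two nodes in the group of signed permutations already differ at
    one letter. *)
Lemma simple_inj (W : finGroupType) (D : coxeter_system W (@Dmat n)) : injective D.
Proof.
have rel s t : ((signed_perm s * signed_perm t) ^+ Dmat s t = 1)%g.
  apply/permP=> x; rewrite perm1; apply: signed_pt_inj.
  rewrite -[RHS](refl_fun_rel s t); elim: (Dmat s t) => [|k IHk]; first by rewrite perm1.
  by rewrite expgSr permM /= -IHk permM !permE !signed_reflE.
have [phi _ phiD] := simple_univ D rel.
have pt s t x : D s = D t -> refl_fun s (signed_pt x) = refl_fun t (signed_pt x).
  move=> /(congr1 phi); rewrite !phiD => /permP/(_ x).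
  by rewrite !permE -!signed_reflE => ->.
have lt_Sn (k : 'I_n.+1) : (k < n.+2)%N by apply: ltnW; rewrite ltnS.
move=> [k|] [l|] // /pt E.
- have [] := E (false, Ordinal (lt_Sn k)); rewrite /= /adjswap eqxx.
  by do 2?case: ifP => [/eqP h|_]; try lia; move=> _; congr Some; apply: val_inj.
- by have [] := E (false, ord0).
- by have [] := E (false, ord0).
Qed.

End SignedPermutations.

(** * The diagram as a rooted tree *)

Section Diagram.

Variable n : nat.
Hypothesis n_gt0 : (0 < n)%N.

Local Notation node := (Dnode n).

(** Heights turn the diagram into a graph over the path 0, 1, ..., n, in which only
    height 0 is occupied twice: adjacency is a difference of heights. *)
Definition height (i : node) : nat := if i is Some a then a else 0.
Definition node_at (k : nat) : node := Some (inord k).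

Local Notation nd := node_at.

Lemma height_le i : (height i <= n)%N.
Proof. by case: i => //= a; rewrite -ltnS. Qed.

Lemma height_at k : (k <= n)%N -> height (nd k) = k.
Proof. by move=> le_kn; rewrite /= inordK. Qed.

Lemma height_inj i k : (0 < height i)%N -> height i = height k -> i = k.
Proof. by case: i k => [a|] [b|] //=; [move=> _ /val_inj-> | move=> /[swap] ->]. Qed.

Arguments height : simpl never.
Arguments node_at : simpl never.

Lemma node_at_height i : (0 < height i)%N -> nd (height i) = i.
Proof. by move=> i0; symmetry; apply: height_inj; rewrite ?height_at ?height_le. Qed.

Lemma height_eq0 i : (height i == 0%N) = (i == node0p n) || (i == node0m n).
Proof. by case: i => [a|] //; apply/esym/orbF. Qed.

Lemma adjE (i k : node) :
  Dadj i k = ((height i).+1 == height k) || ((height k).+1 == height i).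
Proof. by case: i k => [a|] [b|] //=; rewrite ?orbF // eq_sym. Qed.

Lemma adj_sym (i k : node) : Dadj i k = Dadj k i.
Proof. by rewrite !adjE orbC. Qed.

(** The neighbour of i on the way to t; a junk value when i = t. *)
Definition towards (t i : node) : node :=
  if (height t < height i)%N then (if height i == 1%N then t else nd (height i).-1)
  else nd (height i).+1.

(** The distance from i to t; the two fork nodes are at distance 2. *)
Definition nsteps (t i : node) : nat :=
  if height i == height t then (if i == t then 0 else 2)
  else (height i - height t + (height t - height i))%N.

Lemma nsteps0 t : nsteps t t = 0%N.
Proof. by rewrite /nsteps !eqxx. Qed.

Lemma height_neq t i : i != t -> height i = height t -> height t = 0%N.
Proof.
move=> neq_it E; apply/eqP; rewrite -leqn0 leqNgt; apply: contra neq_it => t0.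
by apply/eqP/height_inj => //; rewrite E.
Qed.

Lemma height_towards t i : i != t ->
  height (towards t i) = if (height t < height i)%N then (height i).-1 else (height i).+1.
Proof.
move=> neq_it; rewrite /towards; have := height_le t; have := height_le i.
have := height_neq neq_it.
case: (ltngtP (height t) (height i)) => [lt_ti|lt_it|E] h h1 h2.
- case: eqP => E1; last by rewrite height_at //; lia.
  by lia.
- by rewrite height_at //; lia.
- by rewrite height_at //; have := h (esym E); lia.
Qed.

Lemma adj_towards t i : i != t -> Dadj i (towards t i).
Proof.
move=> neq_it; rewrite adjE height_towards //.
by case: ltnP => h; rewrite ?eqxx ?orbT //; apply/orP; right; apply/eqP; lia.
Qed.

Lemma nsteps_towards t i : i != t -> nsteps t i = (nsteps t (towards t i)).+1.
Proof.
move=> neq_it; rewrite /nsteps (negPf neq_it) height_towards //.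
have := height_neq neq_it; have hi := height_le i.
case: (ltngtP (height i) (height t)) => [lt_it|lt_ti|E] /= h.
- case: ifP => [/eqP E1|/eqP E1]; last by lia.
  have -> : (towards t i == t); last by lia.
  have nlt : (height t < height i)%N = false by lia.
  by apply/eqP/height_inj; rewrite height_towards // nlt.
- case: ifP => [/eqP E1|/eqP E1]; last by lia.
  have -> : (towards t i == t); last by lia.
  apply/eqP; rewrite /towards lt_ti; case: eqP => // neq1.
  by apply: height_inj; rewrite height_at; lia.
- by rewrite E (h E).
Qed.

(** The diagram is a tree: every edge is traversed towards t in exactly one
    direction. *)
Lemma adj_towardsP t k i : Dadj k i ->
  (i != t /\ k = towards t i) \/ (k != t /\ towards t k = i).
Proof.
rewrite adjE => adj.
have ne (a b : node) : height a <> height b -> a != b.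
  by move=> h; apply/eqP => E; apply: h; rewrite E.
have [lt_ti | le_it] := ltnP (height t) (height i).
  have it : i != t by apply: ne; lia.
  have [E | E] := eqVneq (height k) (height i).-1.
    have [E1 | E1] := eqVneq (height i) 1%N.
      have [-> | kt] := eqVneq k t; first by left; rewrite /towards lt_ti E1.
      right; split=> //; rewrite /towards ifN; last by lia.
      by rewrite E E1; symmetry; apply: height_inj; rewrite ?height_at ?E1.
    left; split=> //; rewrite /towards lt_ti (negPf E1) -E node_at_height //; lia.
  right; have kt : k != t by apply: ne; lia.
  split=> //; apply/esym/height_inj; first by lia.
  by rewrite height_towards // ifT; lia.
have [E | E] := eqVneq (height k) (height i).+1; last first.
  right; have kt : k != t by apply: ne; lia.
  split=> //; rewrite /towards ifN; last by lia.
  by rewrite (_ : _.+1 = height i) ?node_at_height //; lia.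
have [lt_it | ge_it] := ltnP (height i) (height t).
  have it : i != t by apply: ne; lia.
  by left; split=> //; rewrite /towards ifN -?E ?node_at_height //; lia.
have Eit : height i = height t by lia.
have kt : k != t by apply: ne; lia.
have [-> | it] := eqVneq i t.
  right; split=> //; rewrite Eit in E; have [t0 | t0] := eqVneq (height t) 0%N.
    by rewrite /towards E t0.
  by apply: esym; apply: height_inj; rewrite ?height_towards // ?E ?leqnn //; lia.
left; split=> //; have t0 := height_neq it Eit.
by rewrite /towards ifN -?E ?node_at_height //; lia.
Qed.

End Diagram.

(** * Elements of paths and the left module of a right node *)

Section PathElements.

Variable n : nat.
Hypothesis n_gt0 : (0 < n)%N.
Variables (W : finGroupType) (D : coxeter_system W (@Dmat n)).
Variables (A : algType laurent) (Hs : Dnode n -> A) (H : W -> A).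
Hypothesis hA : hecke_algebra D Hs H.
Variable bar : {rmorphism A -> A}.
Hypothesis hbar : bar_involution Hs bar.
Variable p : W -> W -> laurent.
Hypothesis hp : KL_polynomials D H bar p.

Local Notation node := (Dnode n).
Local Notation ldes := (left_descent D).
Local Notation l := (ell D).
Local Notation KC := (KL_element D H p).
Local Notation w0 := (longest D).

Lemma Dmat_diag (s : node) : Dmat s s = 1%N.
Proof. by rewrite /Dmat eqxx. Qed.

Let mD := Dmat_diag.

Lemma adj_irr (i : node) : Dadj i i = false.
Proof. by rewrite adjE orbb gtn_eqF. Qed.

Lemma D_eq (i k : node) : (D i == D k) = (i == k).
Proof. exact/inj_eq/simple_inj. Qed.

Lemma D_comm (i k : node) : ~~ Dadj i k -> (D i * D k = D k * D i)%g.
Proof.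
have [-> // | neq_ik] := eqVneq i k; move=> /negPf nadj.
have := simple_rel D i k; rewrite /Dmat (negPf neq_ik) nadj expgS expg1.
move/eqP; rewrite -eq_invg_mul invMg !(simpleV _ mD) => /eqP E.
by rewrite E.
Qed.

Lemma D_braid (i k : node) : Dadj i k ->
  (D i * (D k * D i) = D k * (D i * D k))%g.
Proof.
move=> adj; have neq_ik : i != k by apply: contraTneq adj => ->; rewrite adj_irr.
have := simple_rel D i k; rewrite /Dmat (negPf neq_ik) adj => E.
apply/eqP; rewrite eq_sym -[X in _ == X]invgK eq_sym eq_invg_mul !invMg !(simpleV _ mD).
by rewrite -E !expgS expg0 mulg1 !mulgA.
Qed.

Fixpoint path_elt_rec (t i : node) (k : nat) : W :=
  if k is k'.+1 then (D i * path_elt_rec t (towards t i) k')%g else D i.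

Definition path_elt (t i : node) : W := path_elt_rec t i (nsteps t i).

Lemma path_elt_t t : path_elt t t = D t.
Proof. by rewrite /path_elt nsteps0. Qed.

Lemma path_eltE t i : i != t -> path_elt t i = (D i * path_elt t (towards t i))%g.
Proof. by move=> it; rewrite /path_elt (nsteps_towards n_gt0 it). Qed.

(** The path element of i with its first letter removed. *)
Definition path_tl t i : W := if i == t then 1%g else path_elt t (towards t i).

Lemma path_eltM t i : path_elt t i = (D i * path_tl t i)%g.
Proof.
by rewrite /path_tl; case: eqVneq => [->|/path_eltE //]; rewrite path_elt_t mulg1.
Qed.

(** A second left descent k of i x would, by the rank-two lemmas, be the first
    letter of x, that is, the next node of the path; being adjacent to i, it would
    then make i a left descent of the path two steps further, whose first letter
    cannot be i again. *)
Lemma ldes_path t k i : ldes k (path_elt t i) = (k == i).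
Proof.
have [d] := ubnP (nsteps t i); elim: d k i => // d IHd k i /ltnSE le_d.
have IH j : i != t -> ldes j (path_elt t (towards t i)) = (j == towards t i).
  by move=> it; apply: IHd; rewrite -(nsteps_towards n_gt0 it).
have ndi : ~~ ldes i (path_tl t i).
  rewrite /path_tl; case: eqVneq => [_|it]; first by rewrite ldes1.
  by rewrite IH //; apply: contraTneq (adj_towards n_gt0 it) => <-; rewrite adj_irr.
rewrite path_eltM; have [->|neq_ki] := eqVneq k i; first by rewrite (ldesM _ mD).
apply/negP=> dk.
have neq_ik : D i != D k by rewrite D_eq eq_sym.
have [dk' braid] := ldes_mul mD hA hbar hp ndi dk neq_ik.
move: dk' braid; rewrite /path_tl; case: eqVneq => [_|it]; first by rewrite ldes1.
rewrite IH // => /eqP-> /(_ (D_braid (adj_towards n_gt0 it))).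
rewrite path_eltM (mulKsimple _ mD) /path_tl.
case: eqVneq => [_|tt]; first by rewrite ldes1.
have := nsteps_towards n_gt0 it; rewrite (nsteps_towards n_gt0 tt) => E.
rewrite IHd => [/eqP Ei|]; first by rewrite -Ei in E; lia.
by rewrite E in le_d; lia.
Qed.

Lemma ldes_path_tl t i : ~~ ldes i (path_tl t i).
Proof.
by have := ldes_path t i i; rewrite path_eltM (ldesM _ mD) eqxx => ->.
Qed.

Lemma ell_path t i : l (path_elt t i) = (l (path_tl t i)).+1.
Proof. by rewrite path_eltM (nldes_ell (ldes_path_tl t i)). Qed.

Lemma ell_path_nsteps t i : l (path_elt t i) = (nsteps t i).+1.
Proof.
have [d] := ubnP (nsteps t i); elim: d i => // d IHd i /ltnSE le_d.
rewrite ell_path /path_tl; case: eqVneq => [->|it]; first by rewrite ell1 nsteps0.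
by rewrite (nsteps_towards n_gt0 it) IHd // -(nsteps_towards n_gt0 it).
Qed.

(** The nodes k for which C_{k w_i} occurs in C_i C_{w_i}, seen through
    multiplication by the longest element: the neighbours of i which do not lie on
    the way from i to t. *)
Lemma ldes_mul_path t i k : k != i ->
  ldes i (D k * path_elt t i)%g = ~~ (Dadj k i && ~~ ((i != t) && (k == towards t i))).
Proof.
move=> neq_ki.
have ell_k : l (D k * path_elt t i)%g = (l (path_elt t i)).+1.
  by apply: nldes_ell; rewrite ldes_path.
have [adj | nadj] := boolP (Dadj k i); last first.
  rewrite /left_descent ell_k ell_path path_eltM mulgA D_comm 1?adj_sym //.
  rewrite -mulgA (mulKsimple _ mD) ltnS.
  apply: leq_trans (ell_mul _ _ _) _.
  by rewrite ell_simple.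
have [[it Ek] | [kt Ei]] := adj_towardsP n_gt0 t adj.
  rewrite it Ek eqxx /= -Ek.
  rewrite /left_descent ell_k ell_path path_eltM /path_tl (negPf it) -Ek.
  rewrite ell_path path_eltM.
  have braid := D_braid (i := i) (k := k); rewrite adj_sym in braid.
  have -> : (D i * (D k * (D i * (D k * path_tl t k))) = D k * (D i * path_tl t k))%g.
    rewrite !mulgA -[(D i * D k * D i)%g]mulgA braid // !mulgA.
    by rewrite -[X in (X * _)%g]mulgA simpleK // mulg1.
  rewrite ltnS; apply: leq_trans (ell_mul _ _ _) _; rewrite ell_simple add1n ltnS.
  apply: leq_trans (ell_mul _ _ _) _; rewrite ell_simple add1n.
  exact: leqnn.
have -> : (D k * path_elt t i = path_elt t k)%g by rewrite [RHS]path_eltE // Ei.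
rewrite ldes_path eq_sym (negPf neq_ki).
apply/esym/negbTE; rewrite negbK /=; apply/andP=> -[it /eqP Ek].
have := nsteps_towards n_gt0 it; rewrite -Ek (nsteps_towards n_gt0 kt) Ei; lia.
Qed.

Definition cell_elt t i : W := (path_elt t i * w0)%g.

Lemma ldes_cell t k i : ldes k (cell_elt t i) = (k != i).
Proof. by rewrite (ldes_mul_longest mD hA hbar hp) ldes_path. Qed.

Lemma ell_cell t i : l (cell_elt t i) = (l w0 - (nsteps t i).+1)%N.
Proof. by rewrite (ell_mul_longest mD hA hbar hp) ell_path_nsteps. Qed.

Lemma KC_cell_eig t k i : k != i -> Hs k * KC (cell_elt t i) = vLV *: KC (cell_elt t i).
Proof. by move=> ki; apply: (KC_eig mD hA hbar hp); rewrite ldes_cell. Qed.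

(** The neighbour of i on the way to t comes from the term C_{i w_i}, the other
    neighbours from the correction terms; for i = t the former term is C_{w0}. *)
Lemma Cs_KC_cell t i : Cs Hs i * KC (cell_elt t i) =
  \sum_(k | Dadj k i) KC (cell_elt t k) + (i == t)%:R *: KC w0.
Proof.
rewrite (Cs_KC_codim1 mD hA hbar hp) ?ldes_cell ?eqxx //; last 2 first.
- exact: simple_inj.
- by move=> k ki; rewrite ldes_cell.
rewrite {1}/cell_elt path_eltM -!mulgA (mulKsimple _ mD).
have E k : (k != i) && ldes i (D k * cell_elt t i)%g =
    Dadj k i && ~~ ((i != t) && (k == towards t i)).
  have [->|ki] := eqVneq k i; first by rewrite adj_irr.
  by rewrite /cell_elt mulgA (ldes_mul_longest mD hA hbar hp) ldes_mul_path // negbK.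
rewrite (eq_bigl _ _ E).
have -> : \sum_(k | Dadj k i && ~~ ((i != t) && (k == towards t i)))
      KC (D k * cell_elt t i)%g
    = \sum_(k | Dadj k i && ~~ ((i != t) && (k == towards t i))) KC (cell_elt t k).
  apply: eq_bigr => k /andP[adj nt]; rewrite /cell_elt mulgA.
  have [[it Ek] | [kt Ei]] := adj_towardsP n_gt0 t adj; first by rewrite it Ek eqxx in nt.
  by rewrite [in RHS]path_eltE // Ei.
have [-> | it] := eqVneq i t.
  rewrite /path_tl eqxx mul1g scale1r addrC; congr (_ + _).
  by apply: eq_bigl => k; rewrite andbT.
rewrite scale0r addr0 [RHS](bigD1 (towards t i)) /=; last by rewrite adj_sym adj_towards.
by rewrite /path_tl (negPf it).
Qed.

End PathElements.

(** * A factorization of the longest element *)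

Section MinimalCosetElement.

Variable n : nat.
Hypothesis n_gt0 : (0 < n)%N.
Variables (W : finGroupType) (D : coxeter_system W (@Dmat n)).
Variables (A : algType laurent) (Hs : Dnode n -> A) (H : W -> A).
Hypothesis hA : hecke_algebra D Hs H.
Variable bar : {rmorphism A -> A}.
Hypothesis hbar : bar_involution Hs bar.
Variable p : W -> W -> laurent.
Hypothesis hp : KL_polynomials D H bar p.

Local Notation node := (Dnode n).
Local Notation ldes := (left_descent D).
Local Notation l := (ell D).
Local Notation w0 := (longest D).
Local Notation nd := (@node_at n).
Local Notation n0p := (node0p n).
Local Notation n0m := (node0m n).

Let mD := @Dmat_diag n.

(** The word a...1 0^+ 0^- 1...a.  As a signed permutation it changes the signs of
    two letters, which explains why it nearly commutes with the lower nodes. *)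
Fixpoint fork_elt (a : nat) : W :=
  if a is a'.+1 then (D (nd a) * fork_elt a' * D (nd a))%g else (D n0p * D n0m)%g.

Definition tail_elt (a : nat) : W := (\prod_(a.+1 <= k < n.+1) D (nd k))%g.

(** The final segment of the word n...1 0^+ 0^- 1...n that starts with the letter a
    of its descending half, or with the two fork letters if a = 0. *)
Definition rise_elt (a : nat) : W := (fork_elt a * tail_elt a)%g.

Lemma adj_nd a b : (a <= n)%N -> (b <= n)%N ->
  Dadj (nd a) (nd b) = (a.+1 == b) || (b.+1 == a).
Proof. by move=> an bn; rewrite adjE !height_at. Qed.

Lemma height0p : height n0p = 0%N. Proof. by []. Qed.
Lemma height0m : height n0m = 0%N. Proof. by []. Qed.

Lemma nd_neq a b : (a <= n)%N -> (b <= n)%N -> a != b -> nd a != nd b.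
Proof.
by move=> an bn; apply: contraNneq => E; rewrite -(height_at an) -(height_at bn) E.
Qed.

Lemma tail_eltE a : (a < n)%N -> tail_elt a = (D (nd a.+1) * tail_elt a.+1)%g.
Proof. by move=> an; rewrite /tail_elt big_ltn. Qed.

Lemma tail_elt_n : tail_elt n = 1%g.
Proof. by rewrite /tail_elt big_geq. Qed.

Lemma tail_path a : (a < n)%N -> tail_elt a = path_elt D (nd n) (nd a.+1).
Proof.
have [d] := ubnP (n - a); elim: d a => // d IHd a /ltnSE le_d an.
rewrite tail_eltE //; have [En | neq_n] := eqVneq a.+1 n.
  by rewrite En tail_elt_n mulg1 path_elt_t.
have a1n : (a.+1 < n)%N by rewrite ltn_neqAle neq_n.
rewrite path_eltE // ?nd_neq // IHd //; last by lia.
by rewrite /towards !height_at // ltnNge an.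
Qed.

Lemma fork_path i : height i = 0%N -> (D i * tail_elt 0)%g = path_elt D (nd n) i.
Proof.
move=> i0; rewrite tail_path // [RHS]path_eltE //; last first.
  by apply: contraTneq n_gt0 => E; rewrite -(height_at (leqnn n)) -E i0.
by rewrite /towards i0 ltn0.
Qed.

Lemma rise_eltE a : (a < n)%N -> rise_elt a.+1 = (D (nd a.+1) * rise_elt a)%g.
Proof.
move=> an; rewrite /rise_elt [tail_elt a]tail_eltE //=.
by rewrite !mulgA.
Qed.

Lemma rise_elt_n : rise_elt n = fork_elt n.
Proof. by rewrite /rise_elt tail_elt_n mulg1. Qed.

Lemma D_0p0m : (D n0p * D n0m = D n0m * D n0p)%g.
Proof. by apply: D_comm. Qed.

Lemma rise_elt0 : rise_elt 0 = (D n0p * (D n0m * tail_elt 0))%g.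
Proof. by rewrite /rise_elt /= mulgA. Qed.

Lemma rise_elt0' : rise_elt 0 = (D n0m * (D n0p * tail_elt 0))%g.
Proof. by rewrite /rise_elt /= D_0p0m mulgA. Qed.

Lemma nldes_0p : ~~ ldes n0p (D n0m * tail_elt 0)%g.
Proof. by rewrite fork_path // (ldes_path n_gt0 hA hbar hp). Qed.

Lemma nldes_0m : ~~ ldes n0m (tail_elt 0)%g.
Proof. by rewrite tail_path // (ldes_path n_gt0 hA hbar hp). Qed.

Lemma nldes_tail a : (a < n)%N -> ~~ ldes (nd a.+1) (tail_elt a.+1).
Proof.
move=> an; have [En | neq_n] := eqVneq a.+1 n; first by rewrite En tail_elt_n ldes1.
have a1n : (a.+1 < n)%N by rewrite ltn_neqAle neq_n.
rewrite tail_path // (ldes_path n_gt0 hA hbar hp) nd_neq //.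
by rewrite neq_ltn leqnn.
Qed.

(** Prepending the next letter a+1 to such a segment keeps a as the only other
    candidate for a left descent, and the rank-two lemma for the adjacent nodes
    a and a+1 excludes it.  So the word n...1 0^+ 0^- 1...n is reduced. *)
Lemma ldes_rise a : (a <= n)%N ->
  (forall k, ldes k (rise_elt a) -> height k = a) /\
  (a < n -> ~~ ldes (nd a.+1) (rise_elt a))%N.
Proof.
move=> an; suff ldesr : forall k, ldes k (rise_elt a) -> height k = a.
  split=> // lt_an; apply/negP=> /ldesr; rewrite height_at // => /eqP.
  by rewrite eqn_leq ltnn.
elim/ltn_ind: a an => a IHa an k dk.
have [// | neq] := eqVneq (height k) a.
case: a an IHa dk neq => [|a] an IHa dk neq.
  move: dk; rewrite rise_elt0 => dk.
  have kp : D n0p != D k by rewrite D_eq; apply: contraNneq neq => <-; rewrite height0p.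
  have [] := ldes_mul mD hA hbar hp nldes_0p dk kp.
  rewrite fork_path // (ldes_path n_gt0 hA hbar hp) => /eqP E.
  by rewrite E height0m in neq.
have ka : D (nd a.+1) != D k.
  by rewrite D_eq; apply: contraNneq neq => <-; rewrite height_at.
have nda : ~~ ldes (nd a.+1) (rise_elt a).
  apply/negP=> /(IHa a (leqnn _) (ltnW an)); rewrite height_at // => /eqP.
  by rewrite eqn_leq ltnn.
move: dk; rewrite rise_eltE // => dk.
have [dk' braid] := ldes_mul mD hA hbar hp nda dk ka.
have hk := IHa a (leqnn _) (ltnW an) k dk'.
have adj : Dadj (nd a.+1) k by rewrite adjE height_at // hk eqxx orbT.
have {braid} := braid (D_braid D adj).
case: a an IHa dk neq ka nda dk' hk {adj} => [|a] an IHa dk neq ka nda dk' hk.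
  have [->|->] : k = n0p \/ k = n0m.
    by move/eqP: hk; rewrite height_eq0 => /orP[/eqP->|/eqP->]; [left|right].
    rewrite rise_elt0 (mulKsimple _ mD) fork_path // (ldes_path n_gt0 hA hbar hp).
    by move/eqP/(congr1 (@height n)); rewrite height_at.
  rewrite rise_elt0' (mulKsimple _ mD) fork_path // (ldes_path n_gt0 hA hbar hp).
  by move/eqP/(congr1 (@height n)); rewrite height_at.
have -> : k = nd a.+1 by apply: height_inj; rewrite hk // height_at // ltnW.
rewrite rise_eltE ?(mulKsimple _ mD); last exact: ltnW.
move/(IHa a (leqW (leqnn _)) (ltnW (ltnW an))); rewrite height_at //; lia.
Qed.

Lemma H_rise a : (a < n)%N -> H (rise_elt a.+1) = Hs (nd a.+1) * H (rise_elt a).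
Proof.
move=> an; have [_ /(_ an) nda] := ldes_rise (ltnW an).
by rewrite rise_eltE // (HsH_up hA nda).
Qed.

Lemma H_rise0 : H (rise_elt 0) = Hs n0p * (Hs n0m * H (tail_elt 0)).
Proof. by rewrite rise_elt0 -(HsH_up hA nldes_0p) -(HsH_up hA nldes_0m). Qed.

Lemma H_tail a : (a < n)%N -> H (tail_elt a) = Hs (nd a.+1) * H (tail_elt a.+1).
Proof. by move=> an; rewrite tail_eltE // (HsH_up hA (nldes_tail an)). Qed.

Lemma H_tail_n : H (tail_elt n) = 1.
Proof. by rewrite tail_elt_n (H1 hA). Qed.

Lemma ldes_fork_n : ldes (nd n) (fork_elt n).
Proof.
have lt_n : (n.-1 < n)%N by rewrite prednK.
have : ldes (nd n.-1.+1) (rise_elt n.-1.+1).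
  rewrite rise_eltE // (ldesM _ mD).
  by have [_ ->] := ldes_rise (ltnW lt_n).
by rewrite prednK // rise_elt_n.
Qed.

Lemma ell_rise a : (a <= n)%N -> l (rise_elt a) = (n + 2 + a)%N.
Proof.
elim: a => [_|a IHa an].
  rewrite rise_elt0 (nldes_ell nldes_0p) fork_path //.
  rewrite (ell_path_nsteps n_gt0 hA hbar hp) /nsteps height_at // height0m.
  by rewrite eq_sym gtn_eqF //; lia.
have [_ /(_ an) nda] := ldes_rise (ltnW an).
by rewrite rise_eltE // (nldes_ell nda) IHa ?addnS // ltnW.
Qed.

Lemma nd_comm a k : (a.+1 < k <= n)%N -> commute (D (nd k)) (D (nd a)).
Proof.
case/andP=> ak kn; apply: D_comm; rewrite adj_nd //; last by lia.
by apply/norP; split; apply/eqP; lia.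
Qed.

Lemma nd_comm0 i k : height i = 0%N -> (1 < k <= n)%N -> commute (D (nd k)) (D i).
Proof.
move=> i0 /andP[k1 kn]; apply: D_comm; rewrite adjE height_at // i0.
by apply/norP; split; apply/eqP; lia.
Qed.

Lemma fork_comm_far a k : (a.+1 < k <= n)%N -> commute (D (nd k)) (fork_elt a).
Proof.
elim: a => [|a IHa] ak.
  by apply: commuteM; apply: nd_comm0.
have ak' : (a.+1 < k <= n)%N by lia.
apply: commuteM; last exact: nd_comm.
by apply: commuteM => //; [exact: nd_comm | exact: IHa].
Qed.

(** The case k = a - 1 is the only one that needs the braid relation: it is used
    once on either side of the inner word, which commutes with a. *)
Lemma fork_comm a k : (0 < k < a)%N -> (a <= n)%N -> commute (D (nd k)) (fork_elt a).
Proof.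
elim: a => [|a IHa] ka an; first by lia.
have [Ek | neq_ka] := eqVneq k a; last first.
  have ka' : (0 < k < a)%N by lia.
  have c1 : commute (D (nd k)) (D (nd a.+1)) by apply/commute_sym/nd_comm; lia.
  by apply: commuteM => //; apply: commuteM => //; apply: IHa => //; lia.
case: a Ek ka an {IHa} => [|a] -> ka an; first by lia.
have /D_braid-/(_ W D) braid : Dadj (nd a.+1) (nd a.+2) by rewrite adj_nd ?eqxx // ltnW.
have cu : commute (D (nd a.+2)) (fork_elt a) by apply: fork_comm_far; rewrite leqnn.
rewrite /commute /=; move: (D (nd a.+1)) (D (nd a.+2)) (fork_elt a) braid cu.
move=> x b u braid cu; rewrite !mulgA in braid *.
have := congr1 (mulg (b * x * u)%g) braid; rewrite !mulgA => ->.
by rewrite braid -[(b * x * b * u)%g]mulgA cu !mulgA.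
Qed.

Lemma fork_swap i j a : height i = 0%N -> height j = 0%N -> i != j ->
  (0 < a <= n)%N -> (fork_elt a * D i = D j * fork_elt a)%g.
Proof.
move=> i0 j0 neq_ij; case: a => // a an; elim: a an => [|a IHa] an; last first.
  have ci : commute (D (nd a.+2)) (D i) by apply: nd_comm0.
  have cj : commute (D (nd a.+2)) (D j) by apply: nd_comm0.
  rewrite -[fork_elt a.+2]/(D (nd a.+2) * fork_elt a.+1 * D (nd a.+2))%g.
  rewrite -mulgA ci mulgA -[(_ * D i)%g]mulgA IHa; last exact: ltnW.
  by rewrite !mulgA cj.
have E0 : fork_elt 0 = (D i * D j)%g /\ (D i * D j = D j * D i)%g.
  have [[-> ->]|[-> ->]] : (i = n0p /\ j = n0m) \/ (i = n0m /\ j = n0p).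
  - move/eqP: i0; move/eqP: j0; rewrite !height_eq0.
    by case/orP=> /eqP Ej; case/orP=> /eqP Ei; move: neq_ij; rewrite Ei Ej ?eqxx // => _;
      [right | left].
  - by rewrite /= D_0p0m.
  - by rewrite /= D_0p0m.
case: E0 => E0 cij.
have /D_braid-/(_ W D) bi : Dadj i (nd 1) by rewrite adjE i0 height_at.
have /D_braid-/(_ W D) bj : Dadj j (nd 1) by rewrite adjE j0 height_at.
rewrite [fork_elt 1]/= -/(fork_elt 0) E0.
move: (D (nd 1)) (D i) (D j) cij bi bj => x y z cyz bi bj.
rewrite cyz !mulgA in bi bj *.
by have := congr1 (mulg (x * z)%g) bi; rewrite !mulgA => ->; rewrite -bj.
Qed.

Lemma fork_n_comm s : s != nd n -> exists s', (fork_elt n * D s' = D s * fork_elt n)%g.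
Proof.
move=> neq_sn; have [s0 | s_gt0] := posnP (height s).
  pose s' := if s == n0p then n0m else n0p.
  have s'0 : height s' = 0%N by rewrite /s'; case: ifP.
  have neq_s's : s' != s.
    by rewrite /s'; have [-> // | ] := eqVneq s n0p; rewrite eq_sym.
  by exists s'; apply: fork_swap; rewrite // n_gt0 leqnn.
exists s; rewrite -(node_at_height s_gt0); symmetry; apply: fork_comm => //.
rewrite s_gt0 ltn_neqAle height_le andbT; apply: contra neq_sn => /eqP E.
by apply/eqP/height_inj; rewrite // height_at.
Qed.

Definition Hs_word (ws : seq node) : A := \prod_(s <- ws) Hs s.

(** Starting from u = fork_elt n, ascending letters other than n are prepended as
    long as possible, which gives x = g u with additive lengths.  Moving g through
    u shows that x = u g' with g' of the same length as g, so that n, the first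
    letter of u, is a left descent of x as well.  Hence x is the longest element. *)
Lemma longest_fork : exists js : seq node,
  [/\ nd n \notin js, l w0 = (size js + 2 * n + 2)%N
     & H w0 = Hs_word js * H (fork_elt n)].
Proof.
have ell_fork : l (fork_elt n) = (2 * n + 2)%N by rewrite -rise_elt_n ell_rise //; lia.
suff ascend k js : (l w0 - (size js + 2 * n + 2) < k)%N -> nd n \notin js ->
    l (word_elt D js * fork_elt n)%g = (size js + 2 * n + 2)%N ->
    H (word_elt D js * fork_elt n)%g = Hs_word js * H (fork_elt n) ->
  exists js : seq node,
  [/\ nd n \notin js, l w0 = (size js + 2 * n + 2)%N
     & H w0 = Hs_word js * H (fork_elt n)].
  apply: (ascend (l w0).+1 [::]) => //; first by rewrite ltnS leq_subr.
    by rewrite /word_elt big_nil mul1g ell_fork /=; lia.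
  by rewrite /word_elt /Hs_word !big_nil mul1g mul1r.
elim: k js => // k IHk js; rewrite ltnS => le_k njs ell_x Hx.
set x := (word_elt D js * fork_elt n)%g in ell_x Hx.
have [full | /existsNP[s /not_implyP[neq_s /negP nds]]] :=
    pselect (forall s, s != nd n -> ldes s x); last first.
  have ell_sx := nldes_ell nds; have := longest_max D (D s * x)%g.
  rewrite ell_sx ell_x => le_l.
  apply: (IHk (s :: js)) => /=; rewrite ?word_elt_cons -?mulgA -/x.
  - by move: (size js) (l w0) le_k le_l => a b; lia.
  - by rewrite inE negb_or eq_sym neq_s.
  - by rewrite ell_sx ell_x !addSn.
  - by rewrite -(HsH_up hA nds) Hx mulrA /Hs_word big_cons.
have [js' Ex sz] : exists2 js', x = (fork_elt n * word_elt D js')%g & size js' = size js.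
  rewrite /x; elim: js njs {IHk le_k ell_x Hx full x} => [|s js IHjs].
    by exists [::]; rewrite // /word_elt big_nil mulg1 mul1g.
  rewrite inE negb_or eq_sym => /andP[/fork_n_comm[s' Es] /IHjs[js' Ejs sz]].
  exists (s' :: js'); last by rewrite /= sz.
  by rewrite !word_elt_cons -mulgA Ejs !mulgA Es.
have dn : ldes (nd n) x.
  rewrite /left_descent {1}Ex mulgA; apply: leq_ltn_trans (ell_mul _ _ _) _.
  have := ldes_fork_n; rewrite /left_descent ell_fork ell_x => lt_n.
  rewrite -addnA [(size js + _)%N]addnC -sz; exact: leq_add lt_n (ell_le D js').
have -> : w0 = x.
  apply: esym; apply: (full_longest mD hA hbar hp) => s.
  by have [->|/full] := eqVneq s (nd n).
by exists js.
Qed.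

End MinimalCosetElement.

(** * Quantum integers *)

Fixpoint qint (k : nat) : laurent :=
  if k is k'.+1 then vL * qint k' + vLV ^+ k' else 0.

Lemma qintE k : qint k = \sum_(0 <= j < k) vL ^+ (k.-1 - j) * vLV ^+ j.
Proof.
elim: k => [|k IHk] /=; first by rewrite big_nil.
rewrite big_nat_recr //= subnn mul1r IHk big_distrr /=; congr (_ + _).
rewrite big_nat_cond [RHS]big_nat_cond; apply: eq_bigr => j /andP[/andP[_ lt_j] _].
by rewrite mulrA -exprS; congr (vL ^+ _ * _); lia.
Qed.

Lemma qintS' k : qint k.+1 = vLV * qint k + vL ^+ k.
Proof.
elim: k => [|k IHk] /=; first by rewrite !mulr0 !expr0.
have E : vL * qint k = vLV * qint k + vL ^+ k - vLV ^+ k by rewrite -IHk /= addrK.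
by rewrite [in LHS]E !exprS; ring: vLVK.
Qed.

Lemma qint_rec k : (vL + vLV) * qint k.+1 = qint k.+2 + qint k.
Proof.
have -> : qint k.+2 = vLV * qint k.+1 + vL ^+ k.+1 by apply: qintS'.
rewrite mulrDl addrC -addrA; congr (_ + _).
by rewrite qintS' exprS; ring: vLVK.
Qed.

(** v^k + v^-k, the factor that a node of height k contributes to icartan; each of
    the two fork nodes carries half of v^0 + v^-0. *)
Definition vsym (k : nat) : laurent := if k is 0 then 1 else vL ^+ k + vLV ^+ k.

Lemma vsym_rec k : vsym k.+1 + vsym k.+3 = (vL + vLV) * vsym k.+2.
Proof. by rewrite /vsym !exprS; ring: vLVK. Qed.

Lemma vsym_qint a m :
  vsym a.+2 * qint m.+1 = vsym a.+1 * qint m + vsym (a.+2 + m).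
Proof.
rewrite /vsym addSn -addSn mulrDl {1}qintS' /= !(exprD, exprS).
by ring: vLVK.
Qed.

Arguments qint : simpl never.
Arguments vsym : simpl never.

(** * The action of the longest element *)

Section CellModule.

Variable n : nat.
Hypothesis n_gt0 : (0 < n)%N.
Variables (W : finGroupType) (D : coxeter_system W (@Dmat n)).
Variables (A : algType laurent) (Hs : Dnode n -> A) (H : W -> A).
Hypothesis hA : hecke_algebra D Hs H.
Variable bar : {rmorphism A -> A}.
Hypothesis hbar : bar_involution Hs bar.
Variable p : W -> W -> laurent.
Hypothesis hp : KL_polynomials D H bar p.

Local Notation node := (Dnode n).
Local Notation ldes := (left_descent D).
Local Notation l := (ell D).
Local Notation w0 := (longest D).
Local Notation nd := (@node_at n).
Local Notation n0p := (node0p n).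
Local Notation n0m := (node0m n).
Local Notation KC := (KL_element D H p).
Local Notation cf := (Hcoef hA).

Variable t : node.

Let mD := @Dmat_diag n.
Let b := height t.

(* Z and c i stand for C_{w0} and C_{w_i}.  The computation only uses the action
   of the generators on them. *)
Variables (Z : A) (c : node -> A).
Hypothesis Hs_Z : forall s, Hs s * Z = vLV *: Z.
Hypothesis Hs_c_neq : forall k i, k != i -> Hs k * c i = vLV *: c i.
Hypothesis Hs_c : forall i, Hs i * c i =
  - (vL *: c i) + \sum_(k | Dadj k i) c k + (i == t)%:R *: Z.

(** The vectors along the long branch.  Adding up the two fork vectors in position 0,
    and putting 0 in position n+1, makes the relation Hs_X uniform in a. *)
Definition cell_vec (k : nat) : A :=
  if k == 0%N then c n0p + c n0m else if (k <= n)%N then c (nd k) else 0.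

Local Notation X := cell_vec.

Lemma X_nd k : (0 < k <= n)%N -> X k = c (nd k).
Proof. by case/andP=> k0 kn; rewrite /X gtn_eqF // kn. Qed.

Hypothesis Hs_c_neig : forall i, Hs i * c i <> vLV *: c i.

(* Reduces a linear identity in A to one in the coordinates. *)
Ltac lin := apply: (cf_inj (hA := hA)) => ?; rewrite ?(mulr1n, cfEE).

Lemma sum_adj_nd k : (0 < k <= n)%N ->
  \sum_(j | Dadj j (nd k)) c j = X k.-1 + X k.+1.
Proof.
case/andP=> k0 kn.
have -> : X k.+1 = \sum_(j | height j == k.+1) c j.
  rewrite /X /=; case: ltnP => [lt_kn | le_nk].
    rewrite (big_pred1 (nd k.+1)) // => j.
    apply/eqP/eqP => [E | ->]; last by rewrite height_at.
    by apply: height_inj; rewrite E // height_at.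
  by rewrite big_pred0 // => j; apply/eqP=> E; have := height_le j; lia.
have -> : X k.-1 = \sum_(j | height j == k.-1) c j.
  rewrite /X; case: eqP => [-> | k1].
    rewrite (bigD1 n0p) //= (big_pred1 n0m) // => j; rewrite height_eq0.
    by case: eqVneq => [->|]; rewrite ?andbF ?andbT.
  rewrite ifT; last by lia.
  rewrite (big_pred1 (nd k.-1)) // => j.
  apply/eqP/eqP => [E | ->]; last by rewrite height_at //; lia.
  by apply: height_inj; rewrite ?height_at ?E //; lia.
rewrite (bigID (fun j => height j == k.-1)) /=.
by congr (_ + _); apply: eq_bigl => j; rewrite adjE height_at //; lia.
Qed.

Lemma sum_adj0 i : height i = 0%N -> \sum_(j | Dadj j i) c j = X 1.
Proof.
move=> i0; rewrite X_nd // (big_pred1 (nd 1)) // => j; rewrite adjE i0 /=.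
apply/eqP/eqP => [E | ->]; last by rewrite height_at.
by apply: height_inj; rewrite -?E // height_at.
Qed.

Lemma nd_t a : (0 < a <= n)%N -> (nd a == t) = (a == b).
Proof.
case/andP=> a0 an; apply/eqP/eqP => [E | E]; first by rewrite /b -E height_at.
by apply: height_inj; rewrite height_at.
Qed.

Lemma Hs_X a : (0 < a <= n)%N -> Hs (nd a) * X a =
  - (vL *: X a) + (X a.-1 + X a.+1) + (a == b)%:R *: Z.
Proof. by move=> an; rewrite -sum_adj_nd // X_nd // Hs_c nd_t. Qed.

Lemma Hs_X_neq a k : (0 < a <= n)%N -> k != a -> Hs (nd a) * X k = vLV *: X k.
Proof.
case/andP=> a0 an neq; rewrite /X; case: eqP => [_ | k0].
  by rewrite mulrDr !Hs_c_neq ?scalerDr //; apply/eqP=> /(congr1 (@height n));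
    rewrite height_at // => E; rewrite E in a0.
case: leqP => [kn | _]; last by rewrite mulr0 scaler0.
by rewrite Hs_c_neq // nd_neq // eq_sym.
Qed.

Lemma Hs_X0 i k : height i = 0%N -> (0 < k)%N -> Hs i * X k = vLV *: X k.
Proof.
move=> i0 k0; rewrite /X gtn_eqF //.
case: leqP => [kn | _]; last by rewrite mulr0 scaler0.
rewrite Hs_c_neq //; apply/eqP=> E; move: i0 k0; rewrite E height_at // => ->.
by rewrite ltnn.
Qed.

(** The letters n, n-1, ..., a+1 telescope: each letter shifts the two-term
    combination of vectors down by one, and multiplies by v^-1 the multiple of Z
    which is created at the letter t. *)
Lemma H_tail_X a : (a <= n)%N -> H (tail_elt D a) * X n =
  - (vL *: X a.+1) + X a + (if (a < b)%N then vLV ^+ (b - a.+1) else 0) *: Z.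
Proof.
have [d] := ubnP (n - a); elim: d a => // d IHd a /ltnSE le_d an.
have [-> | neq_an] := eqVneq a n.
  rewrite (H_tail_n hA) mul1r ltnNge height_le /= scale0r addr0.
  by rewrite [X n.+1]/X /= ltnn scaler0 oppr0 add0r.
have lt_an : (a < n)%N by rewrite ltn_neqAle neq_an.
rewrite (H_tail n_gt0 hA hbar hp) // -mulrA IHd //; last by lia.
have neq2 : a.+2 != a.+1 by apply/eqP; lia.
rewrite !mulrDr mulrN -!scalerAr Hs_X // Hs_X_neq // Hs_Z.
have -> : (if (a < b)%N then vLV ^+ (b - a.+1) else 0) =
    (a.+1 == b)%:R + vLV * (if (a.+1 < b)%N then vLV ^+ (b - a.+2) else 0).
  case: (ltngtP a.+1 b) => [lt_ab | lt_ba | <-]; last 2 first.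
  - by rewrite mulr0 addr0.
  - by rewrite subnn mulr0 addr0.
  by rewrite add0r -exprS; congr (_ ^+ _); lia.
by rewrite /=; lin; ring: vLVK.
Qed.

(** The fork letters turn the descending combination into an ascending one, and the
    second half of the word telescopes upwards, meeting the letter t again if t lies
    on the long branch. *)
Lemma H_rise_X a : (a <= n)%N -> H (rise_elt D a) * X n =
  - X a + vLV *: X a.+1 +
  (vLV ^+ (b + a).+1 + (if (0 < b <= a)%N then vLV ^+ (a - b).+1 else 0)) *: Z.
Proof.
elim: a => [_|a IHa an].
  rewrite (H_rise0 n_gt0 hA hbar hp) -!mulrA H_tail_X //.
  have -> : X 0 = c n0p + c n0m by [].
  rewrite !mulrDr !mulrN -!scalerAr.
  rewrite !(Hs_X0 (i := n0m)) // !(Hs_c_neq (k := n0m) (i := n0p)) //.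
  rewrite (Hs_c n0m) sum_adj0 //.
  rewrite !Hs_Z.
  rewrite !(mulrDr, mulrN, =^~ scalerAr) !(Hs_X0 (i := n0p)) //.
  rewrite !(Hs_c_neq (k := n0p) (i := n0m)) //.
  rewrite (Hs_c n0p) sum_adj0 // !Hs_Z.
  have Et : (n0m == t)%:R = (b == 0%N)%:R - (n0p == t)%:R :> laurent.
    rewrite /b height_eq0; have [->|ne] := eqVneq t n0p; first by rewrite /= subrr.
    by rewrite subr0 eq_sym.
  rewrite Et addn0 leqn0; have [-> | b0] := posnP b.
    by rewrite /= expr1; lin; ring: vLVK.
  have Eb : vLV ^+ b = vLV * vLV ^+ (b - 1) by rewrite -exprS subn1 prednK.
  by rewrite /= exprS Eb; lin; ring: vLVK.
rewrite (H_rise n_gt0 hA hbar hp) // -mulrA IHa; last exact: ltnW.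
have an' : (0 < a.+1 <= n)%N by [].
have neq2 : a != a.+1 by apply/eqP; lia.
rewrite !mulrDr mulrN -!scalerAr Hs_X // Hs_X_neq // Hs_Z.
have -> : (if (0 < b <= a.+1)%N then vLV ^+ (a.+1 - b).+1 else 0) =
    vLV * (if (0 < b <= a)%N then vLV ^+ (a - b).+1 else 0) + vLV * (a.+1 == b)%:R.
  case: (ltngtP a.+1 b) => [lt_ab | lt_ba | <-]; rewrite ?mulr0 ?addr0.
  - by rewrite !ifN ?mulr0 //; lia.
  - have hba : (b <= a)%N by [].
    case: (posnP b) => [->|b0] /=; first by rewrite mulr0.
    by rewrite hba -exprS; congr (_ ^+ _); lia.
  - by rewrite ltnn mulr0 add0r subnn mulr1.
by rewrite addnS !exprS /=; lin; ring: vLVK.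
Qed.

Lemma H_Z x : H x * Z = vLV ^+ l x *: Z.
Proof.
have [k] := ubnP (l x); elim: k x => // k IHk x /ltnSE le_k.
have [-> | x1] := eqVneq x 1%g; first by rewrite (H1 hA) mul1r ell1 scale1r.
have [s ds] := ldes_exists D mD x1.
have nds : ~~ ldes s (D s * x)%g by rewrite (ldesM _ mD) ds.
have := HsH_up hA nds; rewrite (mulKsimple _ mD) => <-.
rewrite -mulrA IHk ?(leq_trans ds) // (ldes_ell mD ds).
by rewrite -scalerAr Hs_Z scalerA exprSr.
Qed.

Lemma Hs_word_eig (x : A) js : (forall s, s \in js -> Hs s * x = vLV *: x) ->
  Hs_word Hs js * x = vLV ^+ size js *: x.
Proof.
elim: js => [|s js IHjs] eig_js; first by rewrite /Hs_word big_nil mul1r scale1r.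
rewrite /Hs_word big_cons -mulrA -/(Hs_word Hs js) IHjs => [|s' s'js]; last first.
  by apply: eig_js; rewrite inE s'js orbT.
by rewrite -scalerAr eig_js ?mem_head // scalerA exprSr.
Qed.

(** On X n and on Z the letters of g act by v^-1, so only the action of
    u = fork_elt n has to be computed. *)
Lemma longest_Xn : exists2 k, l w0 = (k + 2 * n + 2)%N &
  H w0 * X n = vLV ^+ k *: (- X n + (vLV ^+ n.+1 * vsym b) *: Z).
Proof.
have [js [njs El EH]] := longest_fork n_gt0 hA hbar hp.
exists (size js) => //.
rewrite EH -mulrA -rise_elt_n H_rise_X // [X n.+1]/X /= ltnn scaler0 addr0.
rewrite mulrDr mulrN -scalerAr !Hs_word_eig; last 2 first.
- by move=> s _; apply: Hs_Z.
- move=> s js_s; rewrite X_nd ?n_gt0 ?leqnn // Hs_c_neq //.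
  by apply: contraNneq njs => <-.
have -> : vLV ^+ (b + n).+1 + (if (0 < b <= n)%N then vLV ^+ (n - b).+1 else 0) =
    vLV ^+ n.+1 * vsym b.
  rewrite height_le andbT -addnS exprD; case: posnP => [b0 | b_gt0].
    by rewrite {}b0 addr0 mul1r mulr1.
  have -> : vsym b = vL ^+ b + vLV ^+ b by case: (b) b_gt0.
  have bn : (b <= n.+1)%N by apply: leqW; apply: height_le.
  have -> : vLV ^+ n.+1 = vLV ^+ b * vLV ^+ (n - b).+1.
    by rewrite -exprD; congr (_ ^+ _); have := height_le t; rewrite -/b; lia.
  have Eb : vL ^+ b * vLV ^+ b = 1 by rewrite vLX_sub // subnn.
  by ring: Eb.
by lin; ring.
Qed.

(** Row t of the inverse of the quantum Cartan matrix, multiplied by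
    v^(n+1) + v^-(n+1) to clear the denominator, at the node of height a > 0. *)
Definition icartan (a : nat) : laurent :=
  if (a <= b)%N then vsym a * qint (n.+1 - b) else vsym b * qint (n.+1 - a).

Lemma icartan_rec a : (1 < a <= n)%N ->
  icartan a.-1 + icartan a.+1 + (a == b)%:R * vsym n.+1 = (vL + vLV) * icartan a.
Proof.
case: a => [|[|a]] // /andP[_ an]; rewrite /icartan /=.
have bn : (b <= n)%N by apply: height_le.
case: (ltngtP a.+2 b) => [lt_ab | lt_ba | Eb]; rewrite /= ?mul0r ?addr0 ?mul1r.
- rewrite (_ : (a.+1 <= b)%N); last by lia.
  by rewrite -mulrDl vsym_rec mulrA.
- have [k Ek] : exists k, (n.+1 - a.+2 = k.+1)%N by exists (n - a.+2)%N; lia.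
  rewrite Ek (_ : (n.+1 - a.+3 = k)%N); last by lia.
  rewrite mulrCA qint_rec mulrDr; congr (_ + _).
  case: (leqP a.+1 b) => [le_ab|_] /=; last by congr (_ * qint _); lia.
  have -> : b = a.+1 by lia.
  by congr (_ * qint _); lia.
- rewrite -Eb leqnSn.
  have [k Ek] : exists k, (n.+1 - a.+2 = k.+1)%N by exists (n - a.+2)%N; lia.
  rewrite Ek (_ : (n.+1 - a.+3 = k)%N); last by lia.
  rewrite (_ : n.+1 = a.+2 + k.+1)%N; last by lia.
  by rewrite mulrCA qint_rec [RHS]mulrDr vsym_qint; ring.
Qed.

Lemma scale_vVXI k (x y : A) : vLV ^+ k *: x = vLV ^+ k *: y -> x = y.
Proof.
move/(congr1 (fun z => vL ^+ k *: z)); rewrite !scalerA vLX_sub // subnn.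
by rewrite !scale1r.
Qed.

Section LongestAction.

Variable k : nat.
Hypothesis El : l w0 = (k + 2 * n + 2)%N.
Hypothesis EXn : H w0 * X n = vLV ^+ k *: (- X n + (vLV ^+ n.+1 * vsym b) *: Z).

(** If w0 conjugated nd a to another node s, then H_{nd a} H_{w0} = H_{w0} H_s
    would make X a an eigenvector of H_{nd a}. *)
Lemma longest_conj_fixed a d : (0 < a <= n)%N ->
  H w0 * X a = vLV ^+ k *: (- X a + d *: Z) -> (D (nd a) * w0 = w0 * D (nd a))%g.
Proof.
move=> an EX; have [s Es] := longest_conj mD hA hbar hp (nd a).
have [E|neq] := eqVneq s (nd a); first by rewrite -{1}E Es.
have Hs_Xa : Hs s * X a = vLV *: X a by rewrite X_nd // Hs_c_neq.
have := congr1 (fun y => y * X a)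
  (H_longest_conj mD hA (longest_conj_sym mD hA hbar hp Es)).
rewrite -!mulrA Hs_Xa -scalerAr EX -scalerAr mulrDr mulrN -scalerAr Hs_Z => E.
case: (@Hs_c_neig (nd a)); rewrite -X_nd //.
apply: (@scale_vVXI k); move: E; move: (Hs _ * X a) => y E.
have <- : vLV ^+ k *: (d *: (vLV *: Z)) - vLV ^+ k *: (- y + d *: (vLV *: Z)) =
    vLV ^+ k *: y by lin; ring.
by rewrite -E; lin; ring.
Qed.

(** Downward induction on a, carrying two consecutive heights: commuting H_{w0} with
    the generator of height a expresses H_{w0} X_{a-1} by the values at a and a+1. *)
Lemma longest_X a : (0 < a <= n)%N ->
  H w0 * X a = vLV ^+ k *: (- X a + (vLV ^+ n.+1 * icartan a) *: Z).
Proof.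
move: a; suff IH j : (j < n)%N ->
    H w0 * X (n - j) =
      vLV ^+ k *: (- X (n - j) + (vLV ^+ n.+1 * icartan (n - j)) *: Z) /\
    H w0 * X (n - j).+1 =
      vLV ^+ k *: (- X (n - j).+1 + (vLV ^+ n.+1 * icartan (n - j).+1) *: Z).
  move=> a /andP[a0 an]; have [|] := IH (n - a)%N; first by lia.
  by rewrite subKn.
have bn : (b <= n)%N by apply: height_le.
elim: j => [_|j IHj jn].
  rewrite subn0 EXn; split.
    congr (_ *: (_ + (_ * _) *: _)); rewrite /icartan; case: leqP => [nb|_].
      have -> : b = n by lia.
      by rewrite subSnn /qint mulr0 add0r mulr1.
    by rewrite subSnn /qint mulr0 add0r mulr1.
  rewrite [X n.+1]/X /= ltnn mulr0 /icartan leqNgt ltnS bn subnn /qint !mulr0 scale0r.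
  by rewrite oppr0 addr0 scaler0.
have [] := IHj (ltnW jn).
have -> : (n - j = (n - j.+1).+1)%N by lia.
set a := (n - j.+1)%N => E1 E2; split=> //.
have an : (0 < a.+1 <= n)%N by rewrite /a; lia.
have an2 : (1 < a.+1 <= n)%N by rewrite /a; lia.
have := congr1 (fun y => y * X a.+1) (H_longest_conj mD hA (longest_conj_fixed an E1)).
rewrite -!mulrA E1 Hs_X // !mulrDr mulrN -!scalerAr E1 E2 (H_Z w0) El.
rewrite mulrDr mulrN -scalerAr Hs_X // Hs_Z /=.
move: (H w0 * X a) => y E.
have Ek : vLV ^+ (k + 2 * n + 2) = vLV ^+ k * vLV ^+ n.+1 * vLV ^+ n.+1.
  by rewrite -!exprD; congr (_ ^+ _); lia.
have vsymn : vsym n.+1 * vLV ^+ n.+1 = 1 + vLV ^+ n.+1 * vLV ^+ n.+1.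
  by rewrite /vsym mulrDl vLX_sub // subnn.
have rec := icartan_rec an2; rewrite /= in rec.
(* m0 collects the terms of H_{w0} H_{nd a.+1} X_{a.+1} that are already known. *)
pose m0 := - (vL *: (vLV ^+ k *: (- X a.+1 + (vLV ^+ n.+1 * icartan a.+1) *: Z))) +
   vLV ^+ k *: (- X a.+2 + (vLV ^+ n.+1 * icartan a.+2) *: Z) +
   (a.+1 == b)%:R *: (vLV ^+ (k + 2 * n + 2) *: Z).
have -> : y = (m0 + y) - m0 by rewrite addrC addKr.
have {E} -> : m0 + y = vLV ^+ k *:
    (- (- (vL *: X a.+1) + (X a + X a.+2) + (a.+1 == b)%:R *: Z) +
     (vLV ^+ n.+1 * icartan a.+1) *: (vLV *: Z)).
  by rewrite -E /m0; lin; ring.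
have -> : icartan a =
    (vL + vLV) * icartan a.+1 - icartan a.+2 - (a.+1 == b)%:R * vsym n.+1.
  by rewrite -rec; ring.
rewrite /m0 Ek; lin; ring: vsymn.
Qed.

Lemma longest_conj_nd a : (0 < a <= n)%N -> (D (nd a) * w0 = w0 * D (nd a))%g.
Proof. by move=> an; apply: longest_conj_fixed (longest_X an). Qed.

Lemma longest_conj_height0 i s :
  height i = 0%N -> (D s * w0 = w0 * D i)%g -> height s = 0%N.
Proof.
move=> i0 Es; apply/eqP; rewrite -leqn0 leqNgt; apply/negP=> s0.
have an : (0 < height s <= n)%N by rewrite s0 height_le.
have := longest_conj_nd an; rewrite node_at_height // Es => /mulgI/simple_inj E.
by rewrite -E i0 in s0.
Qed.

Lemma Hs_braid i j : Dadj i j -> Hs i * (Hs j * Hs i) = Hs j * (Hs i * Hs j).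
Proof.
move=> adj; have neq_ij : i != j by apply: contraTneq adj => ->; rewrite adj_irr.
have := hecke_braid hA i j; rewrite /Dmat (negPf neq_ij) adj /=.
by rewrite !big_cons !big_nil !mulr1.
Qed.

Lemma vDvV_neq0 : vL + vLV != 0.
Proof.
apply/eqP=> /(congr1 (fun x => vL * x)); rewrite mulrDr vLVK mulr0 => E.
apply: in_vZv_neq1; rewrite (_ : 1 = - (vL * vL)).
  by apply/in_vZvN/in_vZvM; apply: in_vZv_v.
by apply/eqP; rewrite -addr_eq0 addrC E.
Qed.

(** The braid relation does not allow a common eigenvector of two adjacent
    generators with different eigenvalues. *)
Lemma braid_eig0 i j x : Dadj i j ->
  Hs i * x = vLV *: x -> Hs j * x = - (vL *: x) -> x = 0.
Proof.
move=> adj Ei Ej.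
have := congr1 (fun y => y * x) (Hs_braid adj); rewrite -!mulrA.
rewrite Ei Ej mulrN -!scalerAr !(Ei, Ej, mulrN) -!scalerAr Ei Ej => E.
apply: (cf_inj (hA := hA)) => w; apply: (laurent_mulI vDvV_neq0).
have := congr1 (fun y => cf y w) E; rewrite !cfEE => Ew.
rewrite mulr0 mulrDl -[X in _ + X]opprK.
have -> : - (vLV * cf x w) = vL * cf x w; last by rewrite subrr.
move: Ew; rewrite !(mulrN, mulNr, opprK) => Ew.
have -> : - (vLV * cf x w) = - (vLV * (vL * (vLV * cf x w))) by ring: vLVK.
by rewrite Ew; ring: vLVK.
Qed.

(** The difference U of the two sides is an eigenvector of H_{nd 1} for v^-1, and of
    H_s for -v; the latter uses the value of H_{w0} X_1. *)
Lemma longest_c0 i s : height i = 0%N -> (0 < b)%N -> (D s * w0 = w0 * D i)%g ->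
  H w0 * c i = vLV ^+ k *: (- c s + (vLV ^+ n.+1 * qint (n.+1 - b)) *: Z).
Proof.
move=> i0 b0 Es; have s0 := longest_conj_height0 i0 Es.
have icartan1 : icartan 1 = (vL + vLV) * qint (n.+1 - b).
  by rewrite /icartan b0 /vsym !expr1.
have an1 : (0 < 1 <= n)%N by [].
have neq_t j : height j = 0%N -> (j == t) = false.
  by move=> j0; apply: contraTF b0 => /eqP Ej; rewrite /b -Ej j0.
apply/eqP; rewrite -subr_eq0; apply/eqP.
set d := _ * qint _; set U := _ - _.
apply: (@braid_eig0 (nd 1) s).
- by rewrite adj_sym adjE s0 height_at.
- have neq1 (j : node) : height j = 0%N -> nd 1 != j.
    by move=> j0; apply/eqP=> /(congr1 (@height n)); rewrite height_at // j0.
  rewrite /U mulrBr mulrA -(H_longest_conj mD hA (longest_conj_nd an1)) -mulrA.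
  rewrite Hs_c_neq ?neq1 // -!scalerAr mulrDr mulrN -scalerAr Hs_c_neq ?neq1 // Hs_Z.
  by lin; ring.
rewrite /U mulrBr mulrA -(H_longest_conj mD hA Es) -mulrA Hs_c neq_t // sum_adj0 //.
rewrite !mulrDr !mulrN -!scalerAr longest_X // !mulrDr !mulrN -!scalerAr.
rewrite Hs_c sum_adj0 // neq_t // Hs_Z icartan1 /d /= ?scale0r.
by lin; ring.
Qed.

End LongestAction.

End CellModule.

(** * Shortest paths in the diagram *)

Section ShortestPaths.

Variable n : nat.
Hypothesis n_gt0 : (0 < n)%N.

Local Notation node := (Dnode n).
Local Notation adj := (@Dadj n).

Definition geodesic (t i : node) : seq node :=
  traject (towards t) (towards t i) (nsteps t i).

Lemma geodesicE t i : i != t -> geodesic t i = towards t i :: geodesic t (towards t i).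
Proof. by move=> it; rewrite /geodesic (nsteps_towards n_gt0 it). Qed.

Lemma geodesic_t t : geodesic t t = [::].
Proof. by rewrite /geodesic nsteps0. Qed.

Lemma nsteps_ind (t : node) (Q : node -> Prop) :
  Q t -> (forall i, i != t -> Q (towards t i) -> Q i) -> forall i, Q i.
Proof.
move=> Qt Qs i; have [d] := ubnP (nsteps t i).
elim: d i => // d IHd i /ltnSE le_d.
have [-> //|it] := eqVneq i t; apply: (Qs _ it); apply: IHd.
by rewrite -(nsteps_towards n_gt0 it).
Qed.

Lemma geodesic_path t i : path adj i (geodesic t i) && (last i (geodesic t i) == t).
Proof.
elim/(@nsteps_ind t): i => [|i it IHi]; first by rewrite geodesic_t /= eqxx.
by rewrite geodesicE //= adj_towards.
Qed.

Lemma nsteps_adj t i j : adj i j ->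
  j = towards t i /\ i != t \/ nsteps t j = (nsteps t i).+1.
Proof.
rewrite adj_sym => /(adj_towardsP n_gt0 t) [[it ->]|[jt Ei]]; first by left.
by right; rewrite (nsteps_towards n_gt0 jt) Ei.
Qed.

(** In a tree a step which does not go towards t increases the distance to t. *)
Lemma path_geodesic t i q : path adj i q -> last i q = t ->
  (nsteps t i <= size q)%N /\ (size q = nsteps t i -> q = geodesic t i).
Proof.
elim: q i => [|j q IHq] i /= => [_ ->|/andP[ij pq] lq].
  by rewrite nsteps0 geodesic_t.
have [le_q uniq_q] := IHq j pq lq.
have [[Ej it] | Ej] := nsteps_adj t ij; last first.
  rewrite Ej in le_q; split; first exact: leqW (ltnW le_q).
  by move=> E; rewrite -E ltnNge leqW // in le_q.
rewrite (nsteps_towards n_gt0 it) -Ej ltnS; split=> // -[/uniq_q ->].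
by rewrite [in RHS]geodesicE // Ej.
Qed.

Lemma nsteps_lt (t i : node) : (nsteps t i < #|node|)%N.
Proof.
rewrite /= card_option card_ord /nsteps; have := height_le i; have := height_le t.
by do 2?case: eqP => _; lia.
Qed.

Lemma dist_nsteps (t i : node) : dist adj i t = nsteps t i.
Proof.
rewrite /dist; set P := (fun k => _); set r := iota _ _.
have nth_r k : (k < #|node|)%N -> nth 0%N r k = k by move=> lt_k; rewrite nth_iota.
have sz_r : size r = #|node| by rewrite size_iota.
have P_n : P (nsteps t i).
  have sz : size (geodesic t i) == nsteps t i by rewrite size_traject.
  by apply/existsP; exists (Tuple sz); apply: geodesic_path.
have has_r : has P r.
  by apply/hasP; exists (nsteps t i); rewrite ?mem_iota ?nsteps_lt.
have lt_find : (find P r < #|node|)%N by rewrite -sz_r -has_find.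
apply/eqP; rewrite eqn_leq; apply/andP; split.
  rewrite leqNgt; apply/negP=> /(before_find 0%N).
  by rewrite nth_r ?nsteps_lt // P_n.
have := nth_find 0%N has_r; rewrite nth_r // => /existsP[q /andP[pq /eqP lq]].
by have [le_q _] := path_geodesic pq lq; rewrite size_tuple in le_q.
Qed.

Lemma shortest_pathE (t i : node) : shortest_path adj i t = i :: geodesic t i.
Proof.
rewrite /shortest_path; congr (_ :: _); case: pickP => [q /andP[pq /eqP lq]|none] /=.
  have [_ ->] := path_geodesic pq lq => //.
  by rewrite size_tuple dist_nsteps.
have sz : size (geodesic t i) == dist adj i t by rewrite size_traject dist_nsteps.
by case/negP: (none (Tuple sz)); apply: geodesic_path.
Qed.

Lemma s_eltE (W : finGroupType) (D : coxeter_system W (@Dmat n)) t i :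
  s_elt D i t = path_elt D t i.
Proof.
rewrite /s_elt shortest_pathE; elim/(@nsteps_ind t): i => [|i it IHi].
  by rewrite geodesic_t big_seq1 path_elt_t.
by rewrite geodesicE // big_cons IHi [RHS]path_eltE //.
Qed.

End ShortestPaths.

(** * Coefficients at the identity *)

Section CellPolynomials.

Variable n : nat.
Hypothesis n_gt0 : (0 < n)%N.
Variables (W : finGroupType) (D : coxeter_system W (@Dmat n)).
Variables (A : algType laurent) (Hs : Dnode n -> A) (H : W -> A).
Hypothesis hA : hecke_algebra D Hs H.
Variable bar : {rmorphism A -> A}.
Hypothesis hbar : bar_involution Hs bar.
Variable p : W -> W -> laurent.
Hypothesis hp : KL_polynomials D H bar p.

Local Notation node := (Dnode n).
Local Notation l := (ell D).
Local Notation w0 := (longest D).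
Local Notation nd := (@node_at n).
Local Notation KC := (KL_element D H p).
Local Notation klp := (KLcoef hA p).
Local Notation cell := (cell_elt D).

Let mD := @Dmat_diag n.

Lemma cell_neq_longest t i : cell t i != w0.
Proof.
apply/eqP=> E; have := longest_full D i.
by rewrite -E (ldes_cell n_gt0 hA hbar hp) eqxx.
Qed.

Lemma KC_cell_neig t i : Hs i * KC (cell t i) <> vLV *: KC (cell t i).
Proof.
have ndi : ~~ left_descent D i (cell t i) by rewrite (ldes_cell n_gt0 hA hbar hp) eqxx.
move=> eig_i; have := eig_cf mD hA eig_i ndi; rewrite -!/(klp _ _) klp_diag klp_eq0.
- by rewrite mulr0 => /eqP; rewrite oner_eq0.
- by apply/eqP=> E; have := nldes_ell ndi; rewrite E => /eqP; rewrite ltn_eqF.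
- by rewrite (nldes_ell ndi).
Qed.

(** The coefficient of H_e on the left-hand side is that of the longest element in
    C_w, which vanishes because w is shorter. *)
Lemma klp1_longest w w' k d : w != w0 ->
  H w0 * KC w = vLV ^+ k *: (- KC w' + d *: KC w0) ->
  klp 1%g w' = d * vL ^+ l w0.
Proof.
have cf1 (x y z : A) : H w0 * x = vLV ^+ k *: (- y + d *: z) ->
    Hcoef hA x (w0^-1)%g = vLV ^+ k * (- Hcoef hA y 1%g + d * Hcoef hA z 1%g).
  by move/(congr1 (fun a => Hcoef hA a 1%g)); rewrite (cf_trace mD hA) !cfEE.
move=> neq_w /cf1; rewrite (longestV mD hA hbar hp) -!/(klp _ _).
have -> : klp w0 w = 0 by rewrite klp_eq0 ?longest_max // eq_sym.
rewrite (klp_full mD hA hbar hp _ (longest_full D)) ell1 expr0 mulr1.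
move/(congr1 (fun x => vL ^+ k * x)); rewrite mulr0 mulrA vLX_sub // subnn mul1r.
by move/eqP; rewrite eq_sym addrC subr_eq0 => /eqP.
Qed.

Lemma qint_expand N a : (0 < a <= n)%N -> (2 * n + 2 <= N)%N ->
  vLV ^+ n.+1 * qint (n.+1 - a) * vL ^+ N =
  \sum_(0 <= k < (n - a).+1) vL ^+ (N - a.+1 - 2 * k).
Proof.
case/andP=> a0 an le_N; rewrite subSn // qintE mulrC mulrA big_distrr /=.
rewrite big_nat_cond [RHS]big_nat_cond; apply: eq_bigr => j /andP[/andP[_ lt_j] _].
have -> : vL ^+ N * vLV ^+ n.+1 * (vL ^+ (n - a - j) * vLV ^+ j) =
    vL ^+ (N + (n - a - j)) * vLV ^+ (n.+1 + j) by rewrite !exprD; ring.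
by rewrite vLX_sub; first congr (_ ^+ _); lia.
Qed.

Lemma longest_KC t : exists2 k, l w0 = (k + 2 * n + 2)%N &
  (forall a, (0 < a <= n)%N -> H w0 * KC (cell t (nd a)) =
     vLV ^+ k *: (- KC (cell t (nd a)) + (vLV ^+ n.+1 * icartan t a) *: KC w0)) /\
  (forall s, height s = 0%N -> (0 < height t)%N -> exists i, H w0 * KC (cell t i) =
     vLV ^+ k *: (- KC (cell t s) + (vLV ^+ n.+1 * qint (n.+1 - height t)) *: KC w0)).
Proof.
pose c i := KC (cell t i); pose Z := KC w0.
have Hs_Z s : Hs s * Z = vLV *: Z := KC_eig mD hA hbar hp (longest_full D s).
have Hs_c_neq k i : k != i -> Hs k * c i = vLV *: c i.
  exact: (KC_cell_eig n_gt0 hA hbar hp).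
have Hs_c i : Hs i * c i =
    - (vL *: c i) + \sum_(k | Dadj k i) c k + (i == t)%:R *: Z.
  have := Cs_KC_cell n_gt0 hA hbar hp t i; rewrite /Cs mulrDl mulr_algl -/Z -/(c i) => E.
  apply: (addIr (vL *: c i)); rewrite E [RHS]addrC [RHS]addrA; congr (_ + _).
  by rewrite addNKr.
have Hs_c_neig i : Hs i * c i <> vLV *: c i by apply: KC_cell_neig.
have [k El EXn] := longest_Xn n_gt0 hA hbar hp Hs_Z Hs_c_neq Hs_c.
exists k => //; split=> [a an | s s0 t0].
  have := longest_X n_gt0 hA hbar hp Hs_Z Hs_c_neq Hs_c Hs_c_neig El EXn an.
  by rewrite X_nd.
have [i Es] := longest_conj (@Dmat_diag n) hA hbar hp s.
have Ei := longest_conj_sym (@Dmat_diag n) hA hbar hp Es.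
have i0 := longest_conj_height0 n_gt0 hA hbar hp
  Hs_Z Hs_c_neq Hs_c Hs_c_neig El EXn s0 Es.
exists i; exact: (longest_c0 n_gt0 hA hbar hp
  Hs_Z Hs_c_neq Hs_c Hs_c_neig El EXn i0 t0 Ei).
Qed.

Lemma Dhat_height0 (j : node) : height j = 0%N -> height (Dhat j) = 0%N.
Proof.
by rewrite /Dhat => j0; do 3?case: ifP => // _.
Qed.

Lemma Dhat_height (j : node) : (0 < height j)%N -> Dhat j = j.
Proof.
rewrite /Dhat; case: ifP => // _ j0.
by do 2!(case: eqP => [E|_]; first by rewrite E in j0).
Qed.

(** Both kinds of index pairs in the theorem give the same quantum integer: for t
    a fork node the vector at height a is used, for t of height a the vector at
    a fork node. *)
Lemma klp_cell t s a : (0 < a <= n)%N ->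
  (height t = 0%N /\ s = nd a) \/ (height s = 0%N /\ t = nd a) ->
  p 1%g (cell t s) = \sum_(0 <= k < (n - a).+1) vL ^+ (l (cell t s) - 2 * k).
Proof.
move=> an cases; have [a0 a_le] := andP an.
have [k El [E1 E2]] := longest_KC t.
have cell1 : cell t s != 1%g.
  apply/eqP=> E; have := ell_cell n_gt0 hA hbar hp t s; rewrite E ell1 El.
  have := nsteps_lt n_gt0 t s; rewrite card_option card_ord; lia.
rewrite -(klp_p1 (Dmat_diag (n := n)) hA p cell1) (ell_cell n_gt0 hA hbar hp).
have [Est klp_ts] : nsteps t s = a /\
    klp 1%g (cell t s) = vLV ^+ n.+1 * qint (n.+1 - a) * vL ^+ l w0.
  case: cases => [[t0 ->] | [s0 Et]].
    split; first by rewrite /nsteps t0 height_at // gtn_eqF //; lia.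
    rewrite (klp1_longest (cell_neq_longest _ _) (E1 a an)); congr (_ * _ * _).
    by rewrite /icartan t0 leqNgt a0 /vsym mul1r.
  have ht_t : height t = a by rewrite Et height_at.
  split; first by rewrite /nsteps s0 ht_t eq_sym gtn_eqF //; lia.
  have [|i Ei] := E2 s s0; first by rewrite ht_t.
  by rewrite (klp1_longest (cell_neq_longest _ _) Ei) ht_t.
by rewrite klp_ts Est qint_expand // El; lia.
Qed.

End CellPolynomials.

Theorem proposition5p27
  (n : nat) (hn : (2 <= n)%N)
  (W : finGroupType) (D : coxeter_system W (@Dmat n))
  (A : algType laurent) (Hs : Dnode n -> A) (H : W -> A)
  (hA : hecke_algebra D Hs H)
  (bar : {rmorphism A -> A}) (hbar : bar_involution Hs bar)
  (p : W -> W -> laurent) (hp : KL_polynomials D H bar p)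
  (i : 'I_n.+1) (hi : (1 <= i)%N) (y : W)
  (hy : y \in [:: w_elt D (Some i) (node0p n); w_elt D (Some i) (node0m n);
                  w_elt D (node0p n) (Some i); w_elt D (node0m n) (Some i)]) :
  p 1%g y = \sum_(0 <= k < (n - i).+1) vL ^+ (ell D y - 2 * k).
Proof.
have n_gt0 : (0 < n)%N by apply: ltnW.
have an : (0 < i <= n)%N by rewrite hi -ltnS ltn_ord.
have Ei : Some i = node_at n i by apply: height_inj; rewrite ?height_at //; case/andP: an.
have hat_i : Dhat (Some i : Dnode n) = Some i by apply: Dhat_height.
have w_eltE s j : w_elt D s j = cell_elt D (Dhat j) s.
  by rewrite /w_elt s_eltE.
move: hy; rewrite !inE !w_eltE hat_i => /or4P[]/eqP->;
  apply: (klp_cell n_gt0 hA hbar hp an);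
  by [left; split; rewrite // Dhat_height0 | right].
Qed.
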